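(* Let $I$ be a non-empty set, $T=\{z\in\mathbb{C}:|z|=1\}$, and let $K\subseteq T^I$ be a compact set with $\lambda(K)>0$, where $\lambda$ is the product measure on $T^I$ of the normalised Lebesgue measures $\frac{d\theta}{2\pi}$ on each factor. Then $K$ is a set of uniqueness for $\tilde A(\overline{D}^I)$: any $f,g\in\tilde A(\overline{D}^I)$ which coincide on $K$ coincide on $\overline{D}^I$.
   Context: $\overline{D}=\{z\in\mathbb{C}:|z|\le1\}$, products carry the product topology, and $\lambda$ is the regular Borel probability product measure on $T^I$. $\tilde A(\overline{D})$ is the set of functions $h:\overline{D}\to\mathbb{C}\cup\{\infty\}$ such that either $h\equiv\infty$, or $h$ is continuous on $\overline{D}$ (into the Riemann sphere), $h(D)\subseteq\mathbb{C}$ and $h|_D$ is holomorphic, $D$ the open unit disc. $\tilde A(\overline{D}^I)$ is the set of all functions $f:\overline{D}^I\to\mathbb{C}\cup\{\infty\}$ that are continuous and such that for every $j_0\in I$ and every $z=(z_i)_{i\in I}\in\overline{D}^I$ the function $w\mapsto f(\zeta(w))$ belongs to $\tilde A(\overline{D})$, where $\zeta(w)_{j_0}=w$ and $\zeta(w)_j=z_j$ for $j\neq j_0$. *)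

(* Defs.v *)
From HB Require Import structures.
From mathcomp Require Import all_boot all_order all_algebra.
From mathcomp Require Import all_classical all_reals all_analysis.
From mathcomp Require Import complex.
Import Order.TTheory GRing.Theory Num.Theory.
Import numFieldNormedType.Exports numFieldTopology.Exports.

Set Implicit Arguments.
Unset Strict Implicit.
Unset Printing Implicit Defensive.

Local Open Scope classical_set_scope.
Local Open Scope ring_scope.

Section Defs.
Variable R : realType.

Definition Cplx : numClosedFieldType := R[i].

(** The Riemann sphere C ∪ {∞}: one-point compactification of C
    ([None] is the point at infinity, [Some z] is z ∈ C). *)
Definition RSphere := one_point_compactification Cplx.

Definition cDisc : set Cplx := [set w | `|w| <= 1].
Definition oDisc : set Cplx := [set w | `|w| < 1].

(** Ã(D̄): h ≡ ∞ on D̄, or h continuous on D̄ into the Riemann sphere,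
    finite on D and holomorphic on D (complex differentiable at every
    point of D; on D h is finite so odflt 0 \o h coincides with h there). *)
Definition Atilde1 (h : Cplx -> RSphere) : Prop :=
  (forall w, cDisc w -> h w = None) \/
  [/\ {within cDisc, continuous h},
      (forall w, oDisc w -> h w <> None) &
      (forall w, oDisc w -> derivable (fun u => odflt 0 (h u)) w 1)].

Variable I : Type.

Definition CProd := {ptws I -> Cplx}.

Definition cPolydisc : set CProd := [set x | forall i, cDisc (x i)].
Definition Torus : set CProd := [set x | forall i, `|x i| = 1].

Definition zeta (j0 : I) (z : CProd) (w : Cplx) : CProd :=
  fun j => if `[< j = j0 >] then w else z j.

Definition Atilde (f : CProd -> RSphere) : Prop :=
  {within cPolydisc, continuous f} /\
  forall (j0 : I) (z : CProd), cPolydisc z -> Atilde1 (fun w => f (zeta j0 z w)).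

Definition BorelCProd := g_sigma_algebraType (@open CProd).

Definition expi (t : R) : Cplx := (cos t +i* sin t)%C.

Definition arc_cylinder (n : nat) (iota : 'I_n -> I) (a b : 'I_n -> R) : set CProd :=
  [set x | Torus x /\
     forall k, exists t, a k <= t <= b k /\ x (iota k) = expi t].

(** λ is the regular Borel probability product measure on T^I of the
    normalised Lebesgue measures dθ/2π:
    - probability measure on the Borel sets,
    - regular (outer regular on Borel sets, inner regular by compacts
      on open sets),
    - its finite-dimensional marginals are the products of the normalised
      arc-length measures (given on products of closed arcs). *)
Definition is_torus_product_measure (lam : {measure set BorelCProd -> \bar R}) : Prop :=
  [/\ lam setT = 1%E,
      (forall A : set BorelCProd, measurable A ->
         lam A = ereal_inf [set lam U | U in [set U : set CProd | open U /\ A `<=` U]]),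
      (forall U : set CProd, open U ->
         lam U = ereal_sup [set lam K | K in [set K : set CProd | compact K /\ K `<=` U]]) &
      (forall (n : nat) (iota : 'I_n -> I) (a b : 'I_n -> R),
         injective iota -> (forall k, a k <= b k <= a k + 2 * pi) ->
         lam (arc_cylinder iota a b) = (\prod_(k < n) ((b k - a k) / (2 * pi)))%:E)].

End Defs.

(* Main.v *)
Require Import Defs.
From HB Require Import structures.
From mathcomp Require Import all_boot all_order all_algebra.
From mathcomp Require Import all_classical all_reals all_analysis.
From mathcomp Require Import complex.
From mathcomp Require Import ring lra.
Import Order.TTheory GRing.Theory Num.Theory.
Import numFieldNormedType.Exports numFieldTopology.Exports.
Local Open Scope classical_set_scope.
Local Open Scope ring_scope.

Set Implicit Arguments.
Unset Strict Implicit.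
Unset Printing Implicit Defensive.

(** Idea. On the disc: near a point [p] of the circle where [f] and [g] agree, one
    of [f - g] and [1/f - 1/g] is a bounded continuous function [G], holomorphic
    inside, on a half-disc neighbourhood [Q] of [p] (transported by
    [z |-> p exp (i ka z)]), and vanishing on a subset [X] of the diameter of
    positive outer content. A finite sum of reflected Poisson kernels placed at the
    grid cells met by [X] gives a holomorphic [V] whose real part is bounded above,
    small on the boundary away from [X], and bounded below at each interior point;
    the maximum principle for [G exp (N V)] then forces [G = 0]. The maximum
    principle comes from Goursat's theorem on rectangles, and also yields the
    identity theorem, which propagates the equality to the whole disc.

    On the polydisc: by compactness, a closed set of positive measure in the torus
    has, over a closed set of base points of positive measure, fibres in a given
    direction that cannot be covered by arcs of small total length; the theorem on
    the disc then frees that coordinate. Finitely many coordinates can thus be freed,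
    and continuity gives the rest. *)

(** * Real coordinates and the real-valued modulus *)

Section ComplexBasics.
Variable R : realType.
Local Notation C := (Cplx R).

(** [lam] is given through regularity and its values on arc cylinders, on the Borel sets of a
    possibly uncountable product, so slicing by Fubini is not at hand. Size is measured instead by
    [thick], a lower bound for the total length of finite covers by open arcs: for slices of a
    closed set, being covered by given arcs is an open condition on the base point, and a
    subdivision into small cells turns it into a measure estimate. The disc theorem must then start
    from outer content, whence finite sums of kernels in place of Poisson integrals.

    On the sphere, [f - g] is meaningless at a common value infinity and [1/f - 1/g] at a value 0.
    The choice can be made only locally, so the analysis runs on small pieces of the disc. Such a
    piece has an artificial side on which only boundedness of [G] is known; the half disc is chosen
    because reflection in the unit circle makes the real part of the kernel vanish on that side, so
    that [exp (N V)] has modulus 1 there. The lower bound for the real part of [V] at an interior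
    point depends neither on [N], nor on the mesh, nor on the depth of the poles, so letting [N]
    grow gives [G = 0]. *)

Definition cre (z : C) : R := complex.Re z.
Definition cim (z : C) : R := complex.Im z.
Definition mkc (x y : R) : C := (x +i* y)%C.
(** The norm of [C] takes its values in [C], which is only partially ordered; [cmod] is the same
    number in [R], where real arithmetic tactics apply. *)
Definition cmod (z : C) : R := Num.sqrt (cre z ^+ 2 + cim z ^+ 2).

Lemma cmodE (z : C) : `|z| = mkc (cmod z) 0.
Proof. exact: normc_def. Qed.

Lemma mkc_eta (z : C) : mkc (cre z) (cim z) = z. Proof. by case: z. Qed.
Lemma cre_mkc x y : cre (mkc x y) = x. Proof. by []. Qed.
Lemma cim_mkc x y : cim (mkc x y) = y. Proof. by []. Qed.
Lemma mkc_inj (z w : C) : cre z = cre w -> cim z = cim w -> z = w.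
Proof. by move=> h1 h2; rewrite -(mkc_eta z) -(mkc_eta w) h1 h2. Qed.
Lemma mkcM a b c d : mkc a b * mkc c d = mkc (a * c - b * d) (a * d + b * c).
Proof. by []. Qed.
Lemma mkcD a b c d : mkc a b + mkc c d = mkc (a + c) (b + d).
Proof. by []. Qed.
Lemma mkcN a b : - mkc a b = mkc (- a) (- b).
Proof. by []. Qed.
Lemma mkc1 : 1 = mkc 1 0. Proof. by []. Qed.
Lemma creD z w : cre (z + w) = cre z + cre w.
Proof. by rewrite -(mkc_eta z) -(mkc_eta w). Qed.
Lemma cimD z w : cim (z + w) = cim z + cim w.
Proof. by rewrite -(mkc_eta z) -(mkc_eta w). Qed.
Lemma creN z : cre (- z) = - cre z. Proof. by rewrite -(mkc_eta z). Qed.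
Lemma cimN z : cim (- z) = - cim z. Proof. by rewrite -(mkc_eta z). Qed.
Lemma creM z w : cre (z * w) = cre z * cre w - cim z * cim w.
Proof. by rewrite -(mkc_eta z) -(mkc_eta w). Qed.
Lemma cimM z w : cim (z * w) = cre z * cim w + cim z * cre w.
Proof. by rewrite -(mkc_eta z) -(mkc_eta w). Qed.
Lemma cre0 : cre 0 = 0. Proof. by []. Qed.
Lemma cim0 : cim 0 = 0. Proof. by []. Qed.
Lemma cre1 : cre 1 = 1. Proof. by []. Qed.
Lemma cim1 : cim 1 = 0. Proof. by []. Qed.
Definition creimE := (creD, cimD, creN, cimN, creM, cimM, cre_mkc, cim_mkc,
  cre0, cim0, cre1, cim1).

Lemma cmod_ge0 z : 0 <= cmod z. Proof. exact: sqrtr_ge0. Qed.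

Lemma sqr_cmod z : cmod z ^+ 2 = cre z ^+ 2 + cim z ^+ 2.
Proof. by rewrite sqr_sqrtr// addr_ge0// sqr_ge0. Qed.

Lemma cmodM z w : cmod (z * w) = cmod z * cmod w.
Proof. by have := normrM z w; rewrite !cmodE mkcM => -[]; rewrite !mul0r subr0. Qed.

Lemma cmodD z w : cmod (z + w) <= cmod z + cmod w.
Proof. by have := ler_normD z w; rewrite !cmodE mkcD lecE /= => /andP[]. Qed.

Lemma cmodN z : cmod (- z) = cmod z.
Proof. by rewrite /cmod creN cimN !sqrrN. Qed.

Lemma cmod0 : cmod 0 = 0.
Proof. by rewrite /cmod !creimE expr0n addr0 sqrtr0. Qed.

Lemma cmod1 : cmod 1 = 1.
Proof. by rewrite /cmod !creimE expr0n addr0 expr1n sqrtr1. Qed.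

Lemma cmod_eq0 z : (cmod z == 0) = (z == 0).
Proof.
apply/eqP/eqP => [h|->]; last exact: cmod0.
by apply/eqP; rewrite -normr_eq0 cmodE h.
Qed.

Lemma cmodX z n : cmod (z ^+ n) = cmod z ^+ n.
Proof. by elim: n => [|n ih]; rewrite ?expr0 ?cmod1// !exprS cmodM ih. Qed.

Lemma cmodV z : cmod z^-1 = (cmod z)^-1.
Proof.
have [->|z0] := eqVneq z 0; first by rewrite invr0 cmod0 invr0.
apply: (@mulfI _ (cmod z)); first by rewrite cmod_eq0.
by rewrite -cmodM !divff ?cmod1// cmod_eq0.
Qed.

Lemma cmodB z w : cmod z - cmod w <= cmod (z - w).
Proof. by rewrite lerBlDr -{1}(subrK w z); apply: cmodD. Qed.

Lemma cmod_distC z w : cmod (z - w) = cmod (w - z).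
Proof. by rewrite -cmodN opprB. Qed.

Lemma cmod_triangle x y z : cmod (x - z) <= cmod (x - y) + cmod (y - z).
Proof. by rewrite -[in X in X <= _](subrK y x) -addrA; apply: cmodD. Qed.

Lemma cre_le_cmod z : `|cre z| <= cmod z.
Proof. by rewrite -sqrtr_sqr ler_sqrt ?addr_ge0 ?sqr_ge0// lerDl sqr_ge0. Qed.

Lemma cim_le_cmod z : `|cim z| <= cmod z.
Proof. by rewrite -sqrtr_sqr ler_sqrt ?addr_ge0 ?sqr_ge0// lerDr sqr_ge0. Qed.

Lemma cmod_le_reim z : cmod z <= `|cre z| + `|cim z|.
Proof.
rewrite -(@ler_pXn2r _ 2) ?nnegrE ?cmod_ge0 ?addr_ge0//.
rewrite sqr_cmod -!(@real_normK _ (cre z)) -?(@real_normK _ (cim z)) ?num_real//.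
have := normr_ge0 (cre z); have := normr_ge0 (cim z); nra.
Qed.

Lemma cmod_real x : cmod (mkc x 0) = `|x|.
Proof. by rewrite /cmod !creimE expr0n addr0 sqrtr_sqr. Qed.

Lemma cnorm_le1 (z : C) : (`|z| <= 1) = (cmod z <= 1).
Proof. by rewrite cmodE mkc1 lecE /= eqxx. Qed.
Lemma cnorm_lt1 (z : C) : (`|z| < 1) = (cmod z < 1).
Proof. by rewrite cmodE mkc1 ltcE /= eqxx. Qed.
Lemma cnorm_eq1 (z : C) : `|z| = 1 <-> cmod z = 1.
Proof. by rewrite cmodE; split=> [[]//|->]. Qed.

Lemma nbhs_cmodP (z : C) (A : set C) :
  nbhs z A <-> exists2 e : R, 0 < e & forall w, cmod (w - z) < e -> A w.
Proof.
split.
  move/nbhs_ballP => [e /= e0 eA]; exists (cre e).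
    by move: e0; rewrite ltcE => /andP[_].
  move=> w wz; apply: eA; rewrite /ball/= cmodE.
  move: e0; rewrite !ltcE => /andP[/eqP /= e1 _].
  by rewrite e1 eqxx /= cmod_distC.
move=> [e e0 eA]; apply/nbhs_ballP; exists (mkc e 0) => /=.
  by rewrite ltcE /= eqxx.
move=> w; rewrite /ball/= cmodE ltcE/= eqxx /= => wz.
by apply: eA; rewrite cmod_distC.
Qed.

Lemma continuous_cmodP (T : topologicalType) (f : T -> C) (x : T) :
  {for x, continuous f} <->
  forall e : R, 0 < e -> \forall y \near x, cmod (f y - f x) < e.
Proof.
split=> [fx e e0|h A /nbhs_cmodP[e e0 eA]].
  have /fx : nbhs (f x) [set w | cmod (w - f x) < e] by apply/nbhs_cmodP; exists e.
  by [].
by move: (h e e0); apply: filterS => y /= ?; apply: eA.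
Qed.

Lemma continuous_distP (T : topologicalType) (f : T -> R) (x : T) :
  {for x, continuous f} <->
  forall e : R, 0 < e -> \forall y \near x, `|f y - f x| < e.
Proof.
split=> [/cvgrPdist_lt fx e e0|h].
  by move: (fx e e0); apply: filterS => y; rewrite distrC.
by apply/cvgrPdist_lt => e /h; apply: filterS => y; rewrite distrC.
Qed.

Lemma continuous_cmod : continuous (cmod : C -> R).
Proof.
move=> z; apply/continuous_distP => e e0; apply/nbhs_cmodP; exists e => // w wz.
apply: le_lt_trans wz; rewrite ler_norml; have := cmodB z w; have := cmodB w z.
rewrite (cmod_distC z w); lra.
Qed.

Lemma continuous_cre : continuous (cre : C -> R).
Proof.
move=> z; apply/continuous_distP => e e0; apply/nbhs_cmodP; exists e => // w wz.
apply: le_lt_trans wz; apply: le_trans (cre_le_cmod _).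
by rewrite !creimE.
Qed.

Lemma continuous_cim : continuous (cim : C -> R).
Proof.
move=> z; apply/continuous_distP => e e0; apply/nbhs_cmodP; exists e => // w wz.
apply: le_lt_trans wz; apply: le_trans (cim_le_cmod _).
by rewrite !creimE.
Qed.

Lemma continuous_mkc (T : topologicalType) (f g : T -> R) (x : T) :
  {for x, continuous f} -> {for x, continuous g} ->
  {for x, continuous (fun t => mkc (f t) (g t))}.
Proof.
move=> /continuous_distP fx /continuous_distP gx; apply/continuous_cmodP => e e0.
have e20 : 0 < e / 2 by rewrite divr_gt0.
near=> y; rewrite (le_lt_trans (cmod_le_reim _))// !creimE.
have h1 : `|f y - f x| < e / 2 by near: y; apply: fx.
have h2 : `|g y - g x| < e / 2 by near: y; apply: gx.
lra.
Unshelve. all: by end_near. Qed.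

Lemma compact_cbox (r : R) :
  compact [set z : C | - r <= cre z <= r /\ - r <= cim z <= r].
Proof.
have -> : [set z : C | - r <= cre z <= r /\ - r <= cim z <= r] =
  (fun p : R * R => mkc p.1 p.2) @` (`[- r, r] `*` `[- r, r]).
  apply/seteqP; split => [z [h1 h2]|_ [[x y] [/= h1 h2]] <-].
    by exists (cre z, cim z); rewrite ?mkc_eta//=; split; rewrite /= in_itv.
  by move: h1 h2; rewrite !in_itv/=.
apply: continuous_compact; last first.
  by apply: compact_setX; apply: segment_compact.
apply: continuous_subspaceT => p; apply: continuous_mkc.
  exact: cvg_fst.
exact: cvg_snd.
Qed.

Lemma compact_cbounded (A : set C) (r : R) :
  closed A -> (forall z, A z -> cmod z <= r) -> compact A.
Proof.
move=> cA Ar; apply: (subclosed_compact cA (@compact_cbox r)).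
move=> z /Ar zr; split; rewrite -ler_norml.
- exact: le_trans (cre_le_cmod _) zr.
- exact: le_trans (cim_le_cmod _) zr.
Qed.

Lemma chausdorff : hausdorff_space C.
Proof. exact: norm_hausdorff. Qed.

End ComplexBasics.

(** * Complex differentiability and the exponential *)

Section HolomorphicBasics.
Variable R : realType.
Local Notation C := (Cplx R).

Lemma derivable_first_order (K : numFieldType) (f : K -> K) (a l : K) :
  is_derive a 1 f l ->
  forall e : K, 0 < e -> \forall h \near (0 : K), `|f (h + a) - f a - h * l| <= e * `|h|.
Proof.
move=> [df <-] e e0.
have := df => /cvgrPdist_le/(_ e e0); rewrite near_withinE => nh.
near=> h; have [->|h0] := eqVneq h 0.
  by rewrite add0r subrr mul0r subrr normr0 mulr0.
have : h != 0 -> `|'D_1 f a - h^-1 * (f (h * 1 + a) - f a)| <= e by near: h.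
move=> /(_ h0); rewrite mulr1 => H; rewrite -(ler_pM2l (_ : 0 < `|h^-1|)) ?normr_gt0 ?invr_eq0//.
rewrite -normrM mulrBr mulKf// distrC (le_trans H)// mulrCA -normrM mulVf//.
by rewrite normr1 mulr1.
Unshelve. all: by end_near. Qed.

(** The form without division, with real [e] and [d]; it allows [w = z], so estimates need no case
    distinction at the base point. *)
Lemma derivable_cmodP (f : C -> C) (z : C) :
  derivable f z 1 <-> exists l : C, forall e : R, 0 < e ->
    exists2 d : R, 0 < d & forall w, cmod (w - z) < d ->
      cmod (f w - f z - l * (w - z)) <= e * cmod (w - z).
Proof.
split=> [df|[l hl]].
  exists ('D_1 f z) => e e0.
  have /(derivable_first_order (DeriveDef df (erefl _))) : 0 < mkc e 0.
    by rewrite ltcE /= eqxx.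
  move=> /nbhs_cmodP[d d0 H]; exists d => // w wz.
  have := H (w - z); rewrite subr0 => /(_ wz).
  by rewrite subrK (mulrC (w - z)) !cmodE mkcM lecE /= !mul0r subr0 => /andP[].
apply/cvg_ex; exists l; apply/cvgrPdist_le => e e0.
have e1 : 0 < cre e by move: e0; rewrite ltcE => /andP[_].
have [d d0 H] := hl _ e1; rewrite near_withinE.
apply/nbhs_cmodP; exists d => // h; rewrite subr0 => hd h0.
have := H (h + z); rewrite addrK => /(_ hd) Hh.
have -> : e = mkc (cre e) 0.
  by rewrite -[LHS]mkc_eta; move: e0; rewrite ltcE => /andP[/eqP /= <-].
rewrite cmodE lecE /= eqxx /=.
have ch : 0 < cmod h by rewrite lt_neqAle cmod_ge0 eq_sym cmod_eq0 h0.
rewrite -(ler_pM2r ch) -cmodM; apply: le_trans Hh; rewrite le_eqVlt; apply/orP; left.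
rewrite -(cmodN (_ * _)); apply/eqP; congr cmod.
by rewrite [h *: 1]mulr1 /GRing.scale/= mulrBl mulrAC mulVf// mul1r opprB.
Qed.

Lemma derivable_continuous (f : C -> C) (z : C) :
  derivable f z 1 -> {for z, continuous f}.
Proof. by move=> /derivable1_diffP; apply: differentiable_continuous. Qed.

Lemma derivable_compC (f g : C -> C) (z : C) :
  derivable f z 1 -> derivable g (f z) 1 -> derivable (g \o f) z 1.
Proof.
move=> /derivable_cmodP[l hl] /derivable_cmodP[m hm].
apply/derivable_cmodP; exists (m * l) => e e0.
pose A := cmod l + 1; pose B := cmod m + 1.
have A0 : 0 < A by rewrite ltr_wpDl ?cmod_ge0.
have B0 : 0 < B by rewrite ltr_wpDl ?cmod_ge0.
have [d d0 H] := hl _ (@ltr01 R).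
have e10 : 0 < e / 2 / B by rewrite !divr_gt0.
have e20 : 0 < e / 2 / A by rewrite !divr_gt0.
have [d1 d10 H1] := hl _ e10.
have [d2 d20 H2] := hm _ e20.
exists (Num.min d (Num.min d1 (d2 / A))); first by rewrite !lt_min d0 d10 divr_gt0.
move=> w; rewrite !lt_min => /andP[/H h /andP[/H1 h1 wd]].
set u := w - z in h h1 wd *; set v := f w - f z.
have hv : cmod v <= A * cmod u.
  rewrite -(subrK (l * u) v) (le_trans (cmodD _ _))// cmodM mulrDl mul1r addrC.
  by rewrite lerD2l; rewrite mul1r in h.
have vd : cmod v < d2 by rewrite (le_lt_trans hv)// mulrC -ltr_pdivlMr.
have h2 := H2 _ vd; rewrite -/v in h2.
have -> : (g \o f) w - (g \o f) z - m * l * u =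
   (g (f w) - g (f z) - m * v) + m * (v - l * u) by rewrite /=; ring.
rewrite (le_trans (cmodD _ _))// cmodM.
have b1 : e / 2 / A * cmod v <= e / 2 * cmod u.
  by rewrite -mulrA ler_pM2l ?divr_gt0// mulrC ler_pdivrMr// mulrC.
have b2 : cmod m * cmod (v - l * u) <= e / 2 * cmod u.
  rewrite (@le_trans _ _ (B * (e / 2 / B * cmod u)))//.
    by rewrite ler_pM ?cmod_ge0// lerDl.
  rewrite (_ : B * _ = e / 2 * cmod u)//; field.
  by rewrite gt_eqF.
lra.
Qed.

Lemma derivable_mulC (f g : C -> C) (z : C) :
  derivable f z 1 -> derivable g z 1 -> derivable (fun w => f w * g w) z 1.
Proof. by move=> df dg; exact: (derivableM df dg). Qed.

Lemma derivable_addC (f g : C -> C) (z : C) :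
  derivable f z 1 -> derivable g z 1 -> derivable (fun w => f w + g w) z 1.
Proof. by move=> df dg; exact: (derivableD df dg). Qed.

Lemma derivable_oppC (f : C -> C) (z : C) :
  derivable f z 1 -> derivable (fun w => - f w) z 1.
Proof. by move=> df; exact: (derivableN df). Qed.

Lemma derivable_subC (f g : C -> C) (z : C) :
  derivable f z 1 -> derivable g z 1 -> derivable (fun w => f w - g w) z 1.
Proof. by move=> df dg; exact: (derivableB df dg). Qed.

Lemma derivable_invC (f : C -> C) (z : C) :
  f z != 0 -> derivable f z 1 -> derivable (fun w => (f w)^-1) z 1.
Proof. by move=> fz df; exact: (derivableV fz df). Qed.

Lemma near_derivableC (f g : C -> C) (z : C) :
  (\forall w \near z, f w = g w) -> derivable f z 1 -> derivable g z 1.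
Proof.
move=> fg /derivable_cmodP[l hl]; apply/derivable_cmodP; exists l => e e0.
have [d d0 H] := hl e e0; have [d' d'0 H'] := (nbhs_cmodP _ _).1 fg.
exists (Num.min d d'); first by rewrite lt_min d0.
move=> w; rewrite lt_min => /andP[wd wd'].
rewrite -(H' w wd') -(H' z); first exact: H.
by rewrite subrr cmod0.
Qed.

Lemma within_cmodP (A : set C) (f : C -> C) :
  {within A, continuous f} <-> forall z, A z -> forall e : R, 0 < e ->
    exists2 d : R, 0 < d & forall w, A w -> cmod (w - z) < d -> cmod (f w - f z) < e.
Proof.
split=> [/subspace_continuousP h z Az e e0|h].
  have /(h z Az) : nbhs (f z) [set w | cmod (w - f z) < e] by apply/nbhs_cmodP; exists e.
  rewrite /within /= /fmap /= => /nbhs_cmodP[d d0 H]; exists d => // w Aw wz; exact: H.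
apply/subspace_continuousP => z Az B /nbhs_cmodP[e e0 eB].
have [d d0 H] := h z Az e e0.
by apply/nbhs_cmodP; exists d => // w wz Aw; apply: eB; apply: H.
Qed.

Definition cexp (z : C) : C := mkc (expR (cre z) * cos (cim z)) (expR (cre z) * sin (cim z)).

Lemma cexpD z w : cexp (z + w) = cexp z * cexp w.
Proof. by rewrite /cexp mkcM creD cimD expRD cosD sinD; congr mkc; ring. Qed.

Lemma cexp0 : cexp 0 = 1.
Proof. by rewrite /cexp expR0 cos0 sin0 mul1r mulr0. Qed.

Lemma cmod_cexp z : cmod (cexp z) = expR (cre z).
Proof.
apply/eqP; rewrite -(@eqrXn2 _ 2) ?cmod_ge0 ?expR_ge0// sqr_cmod /cexp !creimE.
by rewrite !exprMn -mulrDr cos2Dsin2 mulr1.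
Qed.

Lemma derivable_cexp0 : derivable cexp 0 1.
Proof.
apply/derivable_cmodP; exists 1 => e e0.
(* The error terms [t1] to [t5] below are at most 1, 2, 1, 2 and 1 times [e1 * cmod w], 7 in all.
   That [e1 <= 1] bounds [|1 + x|] by 2 and [|sin y|] by [2 * cmod w]. *)
pose e1 := Num.min (e / 8) 1.
have e10 : 0 < e1 by rewrite lt_min ltr01 divr_gt0.
have e11 : e1 <= 1 by rewrite ge_min lexx orbT.
have e1e : e1 <= e / 8 by rewrite ge_min lexx.
clearbody e1.
have [d1 d10 H1] := (nbhs_ballP _ _).1 (derivable_first_order (is_derive_expR (0:R)) e10).
have [d2 d20 H2] := (nbhs_ballP _ _).1 (derivable_first_order (is_derive_sin (0:R)) e10).
have [d3 d30 H3] := (nbhs_ballP _ _).1 (derivable_first_order (is_derive_cos (0:R)) e10).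
rewrite /= in d10 d20 d30.
exists (Num.min (Num.min d1 d2) (Num.min d3 e1)).
  by rewrite !lt_min d10 d20 d30 e10.
move=> w; rewrite !subr0 cexp0 mul1r !lt_min => /andP[/andP[w1 w2] /andP[w3 w4]].
have hx := cre_le_cmod w; have hy := cim_le_cmod w.
set x := cre w in hx; set y := cim w in hy.
have bl (d t : R) : `|t| < d -> ball (0 : R) d t by rewrite /ball /= sub0r normrN.
have := H1 x (bl _ _ (le_lt_trans hx w1)).
have := H2 y (bl _ _ (le_lt_trans hy w2)).
have := H3 y (bl _ _ (le_lt_trans hy w3)).
rewrite /= !addr0 expR0 sin0 cos0 oppr0 mulr0 !subr0 !mulr1 => h3 h2' h1.
have h2 : `|sin y - y| <= e1 * `|y| by rewrite addr0 in h2'.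
have hw : cexp w - 1 - w = mkc ((expR x - 1 - x) * cos y + (1 + x) * (cos y - 1))
   ((expR x - 1 - x) * sin y + x * sin y + (sin y - y)).
  rewrite /cexp -/x -/y -[w in LHS]mkc_eta -/x -/y mkc1 !mkcN !mkcD; congr mkc; ring.
rewrite hw (le_trans (cmod_le_reim _))// !creimE.
have c1 := cos_max y; have s1 := sin_max y.
have cw := cmod_ge0 w.
have sy : `|sin y| <= 2 * cmod w.
  have := ler_normD (sin y - y) y; rewrite subrK => /le_trans; apply.
  have : e1 * `|y| <= 1 * `|y| by rewrite ler_wpM2r.
  lra.
have t1 : `|(expR x - 1 - x) * cos y| <= e1 * cmod w.
  rewrite normrM -[leRHS]mulr1 ler_pM//.
  by rewrite (le_trans h1)// ler_wpM2l// ltW.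
have t2 : `|(1 + x) * (cos y - 1)| <= 2 * (e1 * cmod w).
  rewrite normrM ler_pM//; last by rewrite (le_trans h3)// ler_wpM2l// ltW.
  by rewrite (le_trans (ler_normD _ _))// normr1; lra.
have t3 : `|(expR x - 1 - x) * sin y| <= e1 * cmod w.
  rewrite normrM -[leRHS]mulr1 ler_pM//.
  by rewrite (le_trans h1)// ler_wpM2l// ltW.
have t4 : `|x * sin y| <= e1 * (2 * cmod w).
  by rewrite normrM ler_pM//; lra.
have t5 : `|sin y - y| <= e1 * cmod w by rewrite (le_trans h2)// ler_wpM2l// ltW.
have := ler_normD ((expR x - 1 - x) * cos y) ((1 + x) * (cos y - 1)).
have := ler_normD ((expR x - 1 - x) * sin y + x * sin y) (sin y - y).
have := ler_normD ((expR x - 1 - x) * sin y) (x * sin y).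
have : e1 * cmod w <= e / 8 * cmod w by rewrite ler_wpM2r.
have : 0 <= e * cmod w by rewrite mulr_ge0// ltW.
lra.
Qed.

Lemma derivable_cexp z : derivable cexp z 1.
Proof.
have -> : cexp = (fun w => cexp z * cexp (w - z)).
  by apply/funext => w; rewrite -cexpD addrC subrK.
have H : derivable (cexp \o (fun w => w - z)) z 1.
  apply: derivable_compC; last by rewrite subrr; apply: derivable_cexp0.
  by apply: derivableB; [exact: derivable_id|exact: derivable_cst].
by apply: derivableM; [exact: derivable_cst|exact: H].
Qed.

Lemma expiE (t : R) : expi t = cexp (mkc 0 t).
Proof. by rewrite /cexp !creimE expR0 !mul1r. Qed.

Lemma cexp2pi z : cexp (z + mkc 0 (2 * pi)) = cexp z.
Proof.
rewrite cexpD -[RHS]mulr1; congr (_ * _).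
by rewrite /cexp !creimE expR0 mulr_natl cos2pi sin2pi mulr1 mulr0.
Qed.

Lemma cmod_expi (t : R) : cmod (expi t) = 1.
Proof. by rewrite expiE cmod_cexp expR0. Qed.

Lemma expiD (s t : R) : expi (s + t) = expi s * expi t.
Proof. by rewrite !expiE -cexpD mkcD addr0. Qed.

End HolomorphicBasics.

(** * Goursat's theorem on rectangles *)

Section Goursat.
Variable R : realType.
Local Notation C := (Cplx R).
Local Notation mu := (@lebesgue_measure R).

Definition segint (a b : R) (f : R -> R) : R := \int[mu]_(x in `[a, b]) f x.

Lemma within_continuous_integrable (a b : R) (f : R -> R) :
  {within `[a, b], continuous f} -> mu.-integrable `[a, b] (EFin \o f).
Proof. by move=> cf; apply: continuous_compact_integrable => //; apply: segment_compact. Qed.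

Lemma segintB (a b : R) (f g : R -> R) :
  {within `[a, b], continuous f} -> {within `[a, b], continuous g} ->
  segint a b (fun x => f x - g x) = segint a b f - segint a b g.
Proof. by move=> cf cg; rewrite /segint RintegralB//; apply: within_continuous_integrable. Qed.

Lemma segintD (a b : R) (f g : R -> R) :
  {within `[a, b], continuous f} -> {within `[a, b], continuous g} ->
  segint a b (fun x => f x + g x) = segint a b f + segint a b g.
Proof. by move=> cf cg; rewrite /segint RintegralD//; apply: within_continuous_integrable. Qed.

Lemma segint_cat (a b c : R) (f : R -> R) : a <= b -> b <= c ->
  {within `[a, c], continuous f} -> segint a c f = segint a b f + segint b c f.
Proof.
move=> ab bc cf; have fi := within_continuous_integrable cf.
apply/eqP; rewrite addrC -subr_eq; apply/eqP; rewrite /segint.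
rewrite (@Rintegral_itvB _ f (BLeft a) (BRight c) b)//.
rewrite Rintegral_itv_obnd_cbnd//.
apply: integrableS fi => //; apply: subset_itvr; rewrite bnd_simp //.
Qed.

Lemma segint_cst (a b k : R) : a <= b -> segint a b (fun=> k) = k * (b - a).
Proof.
move=> ab; rewrite /segint Rintegral_cst//; congr (_ * _).
rewrite [X in fine X](lebesgue_measure_itv `[a, b])/= lte_fin.
by move: ab; rewrite le_eqVlt => /predU1P[->|ab]; rewrite ?ltxx ?subrr // ab.
Qed.

Lemma le_segint (a b : R) (f g : R -> R) : 
  {within `[a, b], continuous f} -> {within `[a, b], continuous g} ->
  (forall x, a <= x <= b -> f x <= g x) -> segint a b f <= segint a b g.
Proof.
move=> cf cg fg; by apply: le_Rintegral => //; exact: within_continuous_integrable.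
Qed.

Lemma within_cst (a b k : R) : {within `[a, b], continuous (fun=> k : R)}.
Proof. by apply: continuous_subspaceT => x; apply: cvg_cst. Qed.

Lemma segint_bound (a b m k : R) (f : R -> R) : a <= b ->
  {within `[a, b], continuous f} ->
  (forall x, a <= x <= b -> `|f x - k| <= m) ->
  `|segint a b f - k * (b - a)| <= m * (b - a).
Proof.
move=> ab cf fk; rewrite ler_norml -(segint_cst k ab).
rewrite -(segintB cf (@within_cst _ _ _)) -mulNr -!segint_cst//.
have c' : {within `[a, b], continuous (fun x => f x - k)}.
  by move=> x; apply: cvgB; [exact: cf|exact: cvg_cst].
by rewrite !le_segint//; try exact: within_cst; move=> x /fk; rewrite ler_norml => /andP[].
Qed.

Variable F : C -> C.
Let u x y := cre (F (mkc x y)).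
Let v x y := cim (F (mkc x y)).

(** The imaginary part of the integral of [F dz] along the boundary, counterclockwise. It suffices
    for the maximum principle, since [F] may first be multiplied by a unimodular constant. *)
Definition rect_flux (x1 x2 y1 y2 : R) : R :=
  segint y1 y2 (fun y => u x2 y - u x1 y) - segint x1 x2 (fun x => v x y2 - v x y1).

Variables X1 X2 Y1 Y2 : R.
Hypothesis dF : forall x y, X1 <= x <= X2 -> Y1 <= y <= Y2 -> derivable F (mkc x y) 1.

Lemma vert_continuous (g : C -> R) x y1 y2 : continuous g -> X1 <= x <= X2 -> Y1 <= y1 -> y2 <= Y2 ->
  {within `[y1, y2], continuous (fun y => g (F (mkc x y)))}.
Proof.
move=> cg hx h1 h2; apply: continuous_in_subspaceT => y; rewrite inE /= in_itv/= => /andP[a b].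
apply: (@continuous_comp _ _ _ (fun y => F (mkc x y)) g); last exact: cg.
apply: (@continuous_comp _ _ _ (fun y => mkc x y) F).
  by apply: continuous_mkc; [exact: cvg_cst|exact: cvg_id].
by apply: derivable_continuous; apply: dF => //; rewrite (le_trans h1)//= (le_trans b).
Qed.

Lemma horiz_continuous (g : C -> R) y x1 x2 : continuous g -> Y1 <= y <= Y2 -> X1 <= x1 -> x2 <= X2 ->
  {within `[x1, x2], continuous (fun x => g (F (mkc x y)))}.
Proof.
move=> cg hx h1 h2; apply: continuous_in_subspaceT => x; rewrite inE /= in_itv/= => /andP[a b].
apply: (@continuous_comp _ _ _ (fun x => F (mkc x y)) g); last exact: cg.
apply: (@continuous_comp _ _ _ (fun x => mkc x y) F).
  by apply: continuous_mkc; [exact: cvg_id|exact: cvg_cst].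
by apply: derivable_continuous; apply: dF => //; rewrite (le_trans h1)//= (le_trans b).
Qed.

Let withinB a b (f g : R -> R) : {within `[a, b], continuous f} -> {within `[a, b], continuous g} ->
   {within `[a, b], continuous (fun x => f x - g x)}.
Proof. by move=> cf cg x; apply: cvgB; [exact: cf|exact: cg]. Qed.

Lemma rect_flux_splitx x1 x2 x3 y1 y2 : X1 <= x1 -> x1 <= x2 -> x2 <= x3 -> x3 <= X2 ->
  Y1 <= y1 -> y1 <= y2 -> y2 <= Y2 ->
  rect_flux x1 x3 y1 y2 = rect_flux x1 x2 y1 y2 + rect_flux x2 x3 y1 y2.
Proof.
move=> a b c d e f g; rewrite /rect_flux.
have h x : X1 <= x -> x <= X2 -> {within `[y1, y2], continuous (u x)}.
  by move=> *; apply: vert_continuous => //; [exact: continuous_cre|apply/andP].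
have k y : Y1 <= y -> y <= Y2 -> {within `[x1, x3], continuous (v ^~ y)}.
  by move=> *; apply: horiz_continuous => //; [exact: continuous_cim|apply/andP].
rewrite (@segint_cat x1 x2 x3)//; last first.
  by apply: withinB; apply: k; lra.
have -> : segint y1 y2 (fun y => u x3 y - u x1 y) =
  segint y1 y2 (fun y => u x3 y - u x2 y) + segint y1 y2 (fun y => u x2 y - u x1 y).
  rewrite -segintD; [|apply: withinB; apply: h; lra|apply: withinB; apply: h; lra].
  by congr segint; apply/funext => y; ring.
by ring.
Qed.

Lemma rect_flux_splity x1 x2 y1 y2 y3 : X1 <= x1 -> x1 <= x2 -> x2 <= X2 ->
  Y1 <= y1 -> y1 <= y2 -> y2 <= y3 -> y3 <= Y2 ->
  rect_flux x1 x2 y1 y3 = rect_flux x1 x2 y1 y2 + rect_flux x1 x2 y2 y3.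
Proof.
move=> a b c d e f g; rewrite /rect_flux.
have h x : X1 <= x -> x <= X2 -> {within `[y1, y3], continuous (u x)}.
  by move=> *; apply: vert_continuous => //; [exact: continuous_cre|apply/andP].
have k y : Y1 <= y -> y <= Y2 -> {within `[x1, x2], continuous (v ^~ y)}.
  by move=> *; apply: horiz_continuous => //; [exact: continuous_cim|apply/andP].
rewrite (@segint_cat y1 y2 y3)//; last first.
  by apply: withinB; apply: h; lra.
have -> : segint x1 x2 (fun x => v x y3 - v x y1) =
  segint x1 x2 (fun x => v x y3 - v x y2) + segint x1 x2 (fun x => v x y2 - v x y1).
  rewrite -segintD; [|apply: withinB; apply: k; lra|apply: withinB; apply: k; lra].
  by congr segint; apply/funext => y; ring.
by ring.
Qed.

(** The affine part of [F] contributes [cre l] times the area to both integrals, and these cancel.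
    The remainder is at most [2 * e * s] at each boundary point, hence [4 * e * s] for a difference
    of opposite sides; two pairs of sides of length at most [s] give the 8. *)
Lemma rect_flux_small px py (l : C) (e d s : R) x1 x2 y1 y2 :
  (forall w, cmod (w - mkc px py) < d ->
     cmod (F w - F (mkc px py) - l * (w - mkc px py)) <= e * cmod (w - mkc px py)) ->
  0 <= e -> 2 * s < d -> x2 - x1 <= s -> y2 - y1 <= s ->
  X1 <= x1 -> x1 <= px <= x2 -> x2 <= X2 -> Y1 <= y1 -> y1 <= py <= y2 -> y2 <= Y2 ->
  `|rect_flux x1 x2 y1 y2| <= 8 * e * s ^+ 2.
Proof.
move=> H e0 sd xs ys hX1 /andP[px1 px2] hX2 hY1 /andP[py1 py2] hY2.
have cs x y : x1 <= x <= x2 -> y1 <= y <= y2 -> cmod (mkc x y - mkc px py) <= 2 * s.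
  move=> /andP[a b] /andP[a' b']; rewrite (le_trans (cmod_le_reim _))// !creimE.
  have : `|x - px| <= s by rewrite ler_norml; lra.
  have : `|y - py| <= s by rewrite ler_norml; lra.
  lra.
have s0 : 0 <= s by lra.
have est x y : x1 <= x <= x2 -> y1 <= y <= y2 ->
  cmod (F (mkc x y) - F (mkc px py) - l * (mkc x y - mkc px py)) <= 2 * e * s.
  move=> hx hy; have c := cs x y hx hy.
  rewrite (le_trans (H _ (le_lt_trans c sd)))// -mulrA mulrCA ler_wpM2l//.
have eu x y : x1 <= x <= x2 -> y1 <= y <= y2 ->
  `|u x y - u px py - (cre l * (x - px) - cim l * (y - py))| <= 2 * e * s.
  move=> hx hy; apply: le_trans (est x y hx hy); apply: le_trans (cre_le_cmod _).
  by rewrite !creimE.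
have ev x y : x1 <= x <= x2 -> y1 <= y <= y2 ->
  `|v x y - v px py - (cre l * (y - py) + cim l * (x - px))| <= 2 * e * s.
  move=> hx hy; apply: le_trans (est x y hx hy); apply: le_trans (cim_le_cmod _).
  by rewrite !creimE.
have B1 : `|segint y1 y2 (fun y => u x2 y - u x1 y) - cre l * (x2 - x1) * (y2 - y1)| <=
   4 * e * s * (y2 - y1).
  apply: segint_bound; first lra.
    by apply: withinB; apply: vert_continuous => //; try exact: continuous_cre; lra.
  move=> y hy; have := eu x2 y _ hy; have := eu x1 y _ hy.
  rewrite !ler_norml => h1 h2.
  have := h1 ltac:(lra); have := h2 ltac:(lra).
  move=> /andP[? ?] /andP[? ?]; lra.
have B2 : `|segint x1 x2 (fun x => v x y2 - v x y1) - cre l * (y2 - y1) * (x2 - x1)| <=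
   4 * e * s * (x2 - x1).
  apply: segint_bound; first lra.
    by apply: withinB; apply: horiz_continuous => //; try exact: continuous_cim; lra.
  move=> x hx; have := ev x y2 hx; have := ev x y1 hx.
  rewrite !ler_norml => h1 h2.
  have := h1 ltac:(lra); have := h2 ltac:(lra).
  move=> /andP[? ?] /andP[? ?]; lra.
rewrite /rect_flux.
have es : 0 <= 4 * e * s by rewrite !mulr_ge0.
have i1 : 4 * e * s * (y2 - y1) <= 4 * e * s * s by rewrite ler_wpM2l.
have i2 : 4 * e * s * (x2 - x1) <= 4 * e * s * s by rewrite ler_wpM2l.
move: B1 B2; rewrite (mulrAC (cre l)) !ler_norml => /andP[? ?] /andP[? ?].
have -> : 8 * e * s ^+ 2 = 4 * e * s * s + 4 * e * s * s by ring.
lra.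
Qed.

(** The flux is the sum of those of the four quarters, so one quarter carries at least a fourth of
    it. Only its corner is recorded, its size being determined by [n]. *)
Lemma goursat_bisect n (a b W H : R) : 0 <= W -> 0 <= H ->
  let w k := W / 2 ^+ k in let h k := H / 2 ^+ k in
  X1 <= a -> a + w n <= X2 -> Y1 <= b -> b + h n <= Y2 ->
  exists p : R * R, [/\ a <= p.1, p.1 + w n.+1 <= a + w n, b <= p.2,
    p.2 + h n.+1 <= b + h n &
    `|rect_flux a (a + w n) b (b + h n)| <=
    4 * `|rect_flux p.1 (p.1 + w n.+1) p.2 (p.2 + h n.+1)| ].
Proof.
move=> W0 H0 w h aX1 aX2 bY1 bY2.
have wS : w n = w n.+1 + w n.+1 by rewrite /w exprS; field.
have hS : h n = h n.+1 + h n.+1 by rewrite /h exprS; field.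
have w0 : 0 <= w n.+1 by rewrite divr_ge0// exprn_ge0.
have h0 : 0 <= h n.+1 by rewrite divr_ge0// exprn_ge0.
rewrite wS hS !addrA in aX2 bY2 *.
set a' := a + w n.+1; set b' := b + h n.+1.
rewrite (@rect_flux_splitx a a' (a' + w n.+1)) ?(@rect_flux_splity _ _ b b' (b' + h n.+1));
  try (rewrite /a' /b'; lra).
apply: contrapT => H1; pose M := `|rect_flux a a' b b' + rect_flux a a' b' (b' + h n.+1) +
      (rect_flux a' (a' + w n.+1) b b' + rect_flux a' (a' + w n.+1) b' (b' + h n.+1))|.
have K p : (p = (a, b)) \/ (p = (a', b)) \/ (p = (a, b')) \/ (p = (a', b')) ->
   4 * `|rect_flux p.1 (p.1 + w n.+1) p.2 (p.2 + h n.+1)| < M.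
  move=> hp; rewrite ltNge; apply/negP => Mle; apply: H1; exists p.
  by split => //; move: hp => [->|[->|[->|->]]]; rewrite /= /a' /b'; lra.
have k1 := K (a, b) ltac:(tauto); have k2 := K (a', b) ltac:(tauto).
have k3 := K (a, b') ltac:(tauto); have k4 := K (a', b') ltac:(tauto).
rewrite /= -/a' -/b' in k1 k2 k3 k4; clear K.
set r1 := rect_flux a a' b b' in M k1 k2 k3 k4.
set r3 := rect_flux a a' b' _ in M k1 k2 k3 k4.
set r2 := rect_flux a' _ b b' in M k1 k2 k3 k4.
set r4 := rect_flux a' _ b' _ in M k1 k2 k3 k4.
have := ler_normD (r1 + r3) (r2 + r4); have := ler_normD r1 r3; have := ler_normD r2 r4.
rewrite -/M; lra.
Qed.

Hypotheses (X12 : X1 <= X2) (Y12 : Y1 <= Y2).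

Lemma goursat : rect_flux X1 X2 Y1 Y2 = 0.
Proof.
pose W := X2 - X1; pose H := Y2 - Y1.
have W0 : 0 <= W by rewrite subr_ge0.
have H0 : 0 <= H by rewrite subr_ge0.
pose w k := W / 2 ^+ k; pose h k := H / 2 ^+ k.
pose ok (n : nat) (p : R * R) := [/\ X1 <= p.1, p.1 + w n <= X2, Y1 <= p.2 & p.2 + h n <= Y2].
pose L n (p : R * R) := rect_flux p.1 (p.1 + w n) p.2 (p.2 + h n).
pose nxt (n : nat) (p q : R * R) := [/\ p.1 <= q.1, q.1 + w n.+1 <= p.1 + w n, p.2 <= q.2,
    q.2 + h n.+1 <= p.2 + h n & `|L n p| <= 4 * `|L n.+1 q| ].
(* The step function is total and constrained only where [ok] holds, so the corners are defined by
   plain recursion and the invariant is proved afterwards. *)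
have [st Hst] : {st : nat * (R * R) -> R * R & forall np, ok np.1 np.2 -> nxt np.1 np.2 (st np)}.
  apply: (@choice _ _ (fun np q => ok np.1 np.2 -> nxt np.1 np.2 q)) => -[n [a b]] /=.
  have [[/= o1 o2 o3 o4]|no] := pselect (ok n (a, b)); last by exists (0, 0).
  by have [q hq] := goursat_bisect W0 H0 o1 o2 o3 o4; exists q.
pose p := fix p n := if n is k.+1 then st (k, p k) else (X1, Y1).
have okp n : ok n (p n).
  elim: n => [|n ih]; first by split; rewrite /w /h /= ?expr0 ?divr1 /W /H; lra.
  have [/= a b c d _] := Hst (n, p n) ih; case: ih => /= *; split => /=; lra.
have nx n : nxt n (p n) (p n.+1) by exact: (Hst (n, p n) (okp n)).
have Ln n : `|L 0%N (p 0%N)| <= 4 ^+ n * `|L n (p n)|.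
  elim: n => [|n ih]; first by rewrite expr0 mul1r.
  by rewrite (le_trans ih)// exprSr -mulrA ler_wpM2l ?exprn_ge0//; case: (nx n).
have mono (m n : nat) : (m <= n)%N -> [/\ (p m).1 <= (p n).1, (p n).1 + w n <= (p m).1 + w m,
   (p m).2 <= (p n).2 & (p n).2 + h n <= (p m).2 + h m].
  elim: n => [|n ih]; first by rewrite leqn0 => /eqP ->.
  rewrite leq_eqVlt ltnS => /orP[/eqP->//|/ih[a b c d]].
  by have [a' b' c' d' _] := nx n; split; lra.
have wge n : 0 <= w n by rewrite divr_ge0// exprn_ge0.
have hge n : 0 <= h n by rewrite divr_ge0// exprn_ge0.
have cross m n : (p m).1 <= (p n).1 + w n /\ (p m).2 <= (p n).2 + h n.
  have := wge m; have := hge m; have := wge n; have := hge n.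
  by have [/mono|/ltnW/mono] := leqP m n; case=> *; split; lra.
(* Left and lower ends increase and stay below every right and upper end, so their suprema lie in
   all the rectangles. *)
pose px := sup (range (fun n => (p n).1)); pose py := sup (range (fun n => (p n).2)).
have hpx n : (p n).1 <= px <= (p n).1 + w n.
  apply/andP; split.
    apply: ub_le_sup; last by exists n.
    by exists ((p 0%N).1 + w 0%N) => _ [m _ <-]; case: (cross m 0%N).
  by apply: ge_sup; [exists (p 0%N).1, 0%N|move=> _ [m _ <-]; case: (cross m n)].
have hpy n : (p n).2 <= py <= (p n).2 + h n.
  apply/andP; split.
    apply: ub_le_sup; last by exists n.
    by exists ((p 0%N).2 + h 0%N) => _ [m _ <-]; case: (cross m 0%N).
  by apply: ge_sup; [exists (p 0%N).2, 0%N|move=> _ [m _ <-]; case: (cross m n)].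
have /derivable_cmodP[l hl] : derivable F (mkc px py) 1.
  apply: dF; [move: (hpx 0%N)|move: (hpy 0%N)]; rewrite /= /w /h expr0 divr1 /W /H; lra.
(* [S / 2 ^+ n] dominates both sides of the [n]-th rectangle, and the factor [4 ^+ n] lost by
   bisecting cancels against its square. *)
pose S := W + H.
have key e : 0 < e -> `|L 0%N (p 0%N)| <= 8 * e * S ^+ 2.
  move=> e0; have [d d0 hd] := hl e e0.
  have [n hn] : exists n : nat, 2 * (S / 2 ^+ n) < d.
    have [n hn] : exists n : nat, 2 * S / d < n%:R.
      by exists (Num.bound (2 * S / d)); apply: archi_boundP; apply: divr_ge0; [apply: mulr_ge0 => //; exact: addr_ge0|exact: ltW].
    exists n; rewrite mulrA ltr_pdivrMr ?exprn_gt0// -ltr_pdivrMl// mulrC (lt_trans hn)//.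
    by rewrite -natrX ltr_nat ltn_expl.
  have [i1 i2 i3 i4] := okp n.
  have := @rect_flux_small px py l e d (S / 2 ^+ n) (p n).1 ((p n).1 + w n) (p n).2 ((p n).2 + h n)
     hd (ltW e0) hn.
  rewrite (addrC _ (w n)) addrK (addrC _ (h n)) addrK -/(w n + _) => K.
  rewrite (le_trans (Ln n))//.
  have -> : 8 * e * S ^+ 2 = 4 ^+ n * (8 * e * (S / 2 ^+ n) ^+ 2).
    have -> : (4 : R) ^+ n = 2 ^+ n * 2 ^+ n by rewrite -exprMn; congr (_ ^+ _); ring.
    by field; rewrite expf_neq0.
  rewrite ler_wpM2l ?exprn_ge0// /L (addrC _ (w n)) (addrC _ (h n)); apply: K => //.
  - by rewrite /w ler_pM2r ?invr_gt0 ?exprn_gt0// lerDl.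
  - by rewrite /h ler_pM2r ?invr_gt0 ?exprn_gt0// lerDr.
  - by rewrite addrC.
  - by rewrite addrC.
  - by rewrite addrC.
  - by rewrite addrC.
have -> : rect_flux X1 X2 Y1 Y2 = L 0%N (p 0%N).
  by rewrite /L /= /w /h expr0 !divr1 /W /H !subrKC.
apply/eqP; rewrite -normr_le0; apply/ler_addgt0Pl => e e0; rewrite addr0.
have D0 : 0 < 8 * (S ^+ 2 + 1) by rewrite mulr_gt0// ltr_wpDl// sqr_ge0.
rewrite (le_trans (key (e / (8 * (S ^+ 2 + 1))) _))// ?divr_gt0//.
rewrite (_ : 8 * _ * _ = e * (8 * S ^+ 2 / (8 * (S ^+ 2 + 1)))); last by ring.
rewrite ger_pMr// ler_pdivrMr// mul1r ler_pM2l// lerDl//.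
Qed.

End Goursat.

(** * The maximum principle *)

Section MaximumPrinciple.
Variable R : realType.
Local Notation C := (Cplx R).

(* Goursat's theorem for [zeta |-> F (z0 + exp zeta)] on a rectangle of height
   [2 pi] compares the means of [F] over two circles about [z0]. *)
Lemma weak_max_principle (F : C -> C) (z0 : C) (r M : R) : 0 < r ->
  (forall w, cmod (w - z0) <= r -> derivable F w 1) ->
  (forall w, cmod (w - z0) = r -> cmod (F w) <= M) -> cmod (F z0) <= M.
Proof.
move=> r0 dF FM; rewrite leNgt; apply/negP => Ma.
set a := cmod (F z0) in Ma.
have M0 : 0 <= M.
  apply: le_trans (FM (z0 + mkc r 0) _); first exact: cmod_ge0.
  by rewrite addrAC subrr add0r cmod_real gtr0_norm.
have a0 : 0 < a by apply: le_lt_trans Ma.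
(* Chosen so that [c * F z0] is the positive number [a]; it is then enough to compare means of real
   parts. *)
pose c : C := mkc (cre (F z0) / a) (- (cim (F z0) / a)).
have c1 : cmod c = 1.
  apply/eqP; rewrite -(@eqrXn2 _ 2) ?cmod_ge0// sqr_cmod !creimE sqrrN !expr_div_n -mulrDl.
  by rewrite -sqr_cmod divff ?expr1n// expf_neq0// gt_eqF.
have cF : cre (c * F z0) = a.
  rewrite !creimE; have := sqr_cmod (F z0); rewrite -/a => E.
  by apply: (@mulIf _ a); rewrite ?gt_eqF// -expr2 E; field; rewrite gt_eqF.
pose G (zeta : C) : C := c * F (z0 + cexp zeta).
have e0 : 0 < (a - M) / 2 by rewrite divr_gt0// subr_gt0.
have cz0 : derivable F z0 1 by apply: dF; rewrite subrr cmod0 ltW.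
have /derivable_continuous/continuous_cmodP/(_ _ e0)/nbhs_cmodP[d d0 Hd] := cz0.
(* Logarithms of the two radii. On the inner circle [F] differs from [F z0] by less than
   [(a - M) / 2]. *)
pose s1 := ln r; pose s0 := Num.min s1 (ln (d / 2)).
have s01 : s0 <= s1 by rewrite ge_min lexx.
have es1 : expR s1 = r by rewrite lnK// posrE.
have es0 : expR s0 < d.
  have : expR s0 <= expR (ln (d / 2)) by rewrite ler_expR ge_min lexx orbT.
  by rewrite lnK ?posrE ?divr_gt0//; lra.
have pi0 := @pi_gt0 R.
have twopi : 0 <= 2 * pi :> R by lra.
have dG x y : s0 <= x <= s1 -> 0 <= y <= 2 * pi -> derivable G (mkc x y) 1.
  move=> /andP[_ xs] _; apply: derivableM; first exact: derivable_cst.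
  apply: (@derivable_compC _ (fun zeta => z0 + cexp zeta) F).
    by apply: derivableD; [exact: derivable_cst|exact: derivable_cexp].
  apply: dF; rewrite addrAC subrr add0r cmod_cexp creimE.
  by rewrite -es1 ler_expR.
have := goursat dG s01 twopi; rewrite /rect_flux.
(* The horizontal sides lie one period of [cexp] apart and cancel, so the two circular means agree.
   But the real part of [G] is at most [M] on the outer circle and at least [(a + M) / 2] on the
   inner one. *)
have -> : (fun x => cim (G (mkc x (2 * pi))) - cim (G (mkc x 0))) = (fun=> 0).
  apply/funext => x; rewrite /G; have := cexp2pi (mkc x 0).
  by rewrite mkcD addr0 add0r => ->; rewrite subrr.
rewrite segint_cst// mul0r subr0 => I0.
have : segint 0 (2 * pi) (fun y => cre (G (mkc s1 y)) - cre (G (mkc s0 y))) <=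
  segint 0 (2 * pi) (fun=> - ((a - M) / 2)).
  apply: le_segint; [|exact: within_cst|].
    move=> y; apply: cvgB.
      by apply: (vert_continuous dG); rewrite ?lexx ?s01//; exact: continuous_cre.
    by apply: (vert_continuous dG); rewrite ?lexx ?s01//; exact: continuous_cre.
  move=> y _.
  have h1 : cre (G (mkc s1 y)) <= M.
    rewrite (le_trans (ler_norm _))// (le_trans (cre_le_cmod _))// cmodM c1 mul1r.
    by apply: FM; rewrite addrAC subrr add0r cmod_cexp creimE.
  have h2 : a - (a - M) / 2 <= cre (G (mkc s0 y)).
    have : cmod (F (z0 + cexp (mkc s0 y)) - F z0) < (a - M) / 2.
      by apply: Hd; rewrite addrAC subrr add0r cmod_cexp creimE.
    rewrite -[cmod _]mul1r -{1}c1 -cmodM mulrBr => /ltW h.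
    have := le_trans (cre_le_cmod _) h.
    by rewrite creD creN cF ler_norml => /andP[]; rewrite /G; lra.
  lra.
rewrite I0 segint_cst//; apply/negP; rewrite -ltNge subr0 mulNr oppr_lt0.
by rewrite mulr_gt0//; lra.
Qed.

Lemma within_compC (T : topologicalType) (S : topologicalType) (A : set T) (F : T -> C) (g : C -> S) :
  {within A, continuous F} -> (forall z, A z -> {for F z, continuous g}) ->
  {within A, continuous (fun w => g (F w))}.
Proof.
move=> /subspace_continuousP cF cg; apply/subspace_continuousP => z Az B hB.
have H := cg z Az B hB; exact: (cF z Az _ H).
Qed.

Definition cconj (z : C) : C := mkc (cre z) (- cim z).

(* On a circle of radius [r] about [c], [|w|^2 = |c|^2 + r^2 + 2 Re (conj c (w - c))];
   multiplying [F] by [cexp (2 e conj c (w - c))] shows that [|F w| exp (e |w|^2)] has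
   no interior maximum other than zero. *)
Lemma max_principle (Q U : set C) (F : C -> C) (M : R) :
  compact Q -> U `<=` Q -> open U -> {within Q, continuous F} ->
  (forall z, U z -> derivable F z 1) ->
  0 <= M -> (forall z, Q z -> ~ U z -> cmod (F z) <= M) ->
  forall z, Q z -> cmod (F z) <= M.
Proof.
move=> cQ UQ oU cF dF M0 bF z Qz.
have Q0 : Q !=set0 by exists z.
have [b _ Hb] := @compact_EVT_max _ _ (@cmod R) Q Q0 cQ (continuous_subspaceT (@continuous_cmod R)).
set B := cmod b in Hb.
have B0 : 0 <= B by exact: cmod_ge0.
have key e : 0 < e -> cmod (F z) <= M * expR (e * B ^+ 2).
  move=> e0; pose u w := cmod (F w) * expR (e * cmod w ^+ 2).
  have cu : {within Q, continuous u}.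
    move=> w; apply: cvgM.
      by apply: (within_compC cF) => *; exact: continuous_cmod.
    apply: (continuous_subspaceT (f := fun w => expR (e * cmod w ^+ 2))) => {}w.
    apply: (@continuous_comp _ _ _ (@cmod R) (fun t => expR (e * t ^+ 2))).
      exact: continuous_cmod.
    apply: (@continuous_comp _ _ _ (fun t : R => e * t ^+ 2)); last exact: continuous_expR.
    by apply: cvgM; [exact: (@cvg_cst R)|exact: exprn_continuous].
  have [c cQ' cmax] := compact_EVT_max Q0 cQ cu.
  rewrite inE in cQ'.
  have uge w : 0 <= u w by rewrite mulr_ge0 ?cmod_ge0 ?expR_ge0.
  have uc : u c <= M * expR (e * B ^+ 2).
    have [Uc|nUc] := pselect (U c); last first.
      rewrite ler_pM ?cmod_ge0 ?expR_ge0 ?bF// ler_expR ler_pM2l// lerXn2r ?nnegrE ?cmod_ge0//.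
      by apply: Hb; rewrite inE.
    suff -> : u c = 0 by rewrite mulr_ge0 ?expR_ge0.
    have [r r0 Hr] := (nbhs_cmodP _ _).1 (open_nbhs_nbhs (conj oU Uc)).
    pose r2 := r / 2; have r20 : 0 < r2 by rewrite divr_gt0.
    have r2r : r2 < r by rewrite /r2; lra.
    pose G w := F w * cexp (mkc (2 * e) 0 * cconj c * (w - c)).
    have : cmod (G c) <= cmod (F c) * expR (- (e * r2 ^+ 2)).
      apply: (@weak_max_principle G c r2) => // [w wr|w wr].
        apply: derivableM; first by apply: dF; apply: Hr; rewrite (le_lt_trans wr).
        apply: (@derivable_compC _ (fun w => mkc (2 * e) 0 * cconj c * (w - c)) (@cexp R)).
          apply: derivableM; first exact: derivable_cst.
          by apply: derivableB; [exact: derivable_id|exact: derivable_cst].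
        exact: derivable_cexp.
      have Qw : w \in Q by rewrite inE; apply: UQ; apply: Hr; rewrite wr.
      have := cmax w Qw; rewrite /u /G cmodM cmod_cexp => h.
      have -> : cre (mkc (2 * e) 0 * cconj c * (w - c)) =
         e * cmod w ^+ 2 - e * cmod c ^+ 2 - e * r2 ^+ 2.
        by rewrite -wr !sqr_cmod /cconj !creimE; ring.
      rewrite expRD expRD mulrA mulrA; rewrite ler_pM2r ?expR_gt0//.
      by rewrite expRN ler_pdivrMr ?expR_gt0.
    rewrite /G subrr mulr0 cexp0 mulr1 /u => h.
    suff -> : cmod (F c) = 0 by rewrite mul0r.
    apply/eqP; rewrite eq_le cmod_ge0 andbT leNgt; apply/negP => F0.
    by move: h; rewrite ler_pMr// -expR0 ler_expR oppr_ge0 leNgt mulr_gt0// exprn_gt0.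
  have := cmax z; rewrite inE => /(_ Qz) h.
  rewrite (le_trans _ (le_trans h uc))// /u ler_peMr ?cmod_ge0//.
  by rewrite -expR0 ler_expR mulr_ge0 ?sqr_ge0// ltW.
rewrite leNgt; apply/negP => Fz.
have [M00|/eqP Mn0] := M =P 0.
  by have := key 1 ltr01; rewrite M00 mul0r leNgt -M00 Fz.
have Mp : 0 < M by rewrite lt_neqAle eq_sym Mn0.
(* With [e] equal to [t / 2 / (B ^+ 2 + 1)], the factor in [key] is at most [exp (t / 2)], which is
   less than [cmod (F z) / M]. The case [M = 0], where no logarithm is available, has been settled
   apart. *)
pose t := ln (cmod (F z) / M).
have t0 : 0 < t by rewrite ln_gt0// ltr_pdivlMr// mul1r.
have B1 : 0 < B ^+ 2 + 1 by rewrite ltr_wpDl// sqr_ge0.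
have := key (t / 2 / (B ^+ 2 + 1)) _; rewrite !divr_gt0// => /(_ isT).
rewrite -ler_pdivrMl// mulrC -[X in X <= _](@lnK _ (cmod (F z) / M)); last first.
  by rewrite posrE divr_gt0// (lt_trans Mp).
rewrite ler_expR -/t; apply/negP; rewrite -ltNge.
have : t / 2 / (B ^+ 2 + 1) * B ^+ 2 <= t / 2.
  rewrite mulrAC ler_pdivrMr// ler_pM2l ?divr_gt0// lerDl//.
lra.
Qed.

End MaximumPrinciple.

(** * Compactness tools and the identity theorem on a disc *)

Section HalfDisc.
Variable R : realType.
Local Notation C := (Cplx R).

Lemma compact_cmod_bound (T : topologicalType) (Q : set T) (F : T -> C) :
  compact Q -> {within Q, continuous F} ->
  exists2 M : R, 1 <= M & forall z, Q z -> cmod (F z) <= M.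
Proof.
move=> cQ cF; have [->|Q0] := eqVneq Q set0; first by exists 1.
have cu : {within Q, continuous (fun w => cmod (F w))}.
  by apply: (within_compC cF) => *; exact: continuous_cmod.
have [c _ Hc] := compact_EVT_max ((set0P _).1 Q0) cQ cu.
exists (Num.max 1 (cmod (F c))); first by rewrite le_max lexx.
by move=> z Qz; rewrite le_max Hc ?orbT// inE.
Qed.

Lemma derivable_within (A : set C) (F : C -> C) :
  (forall z, A z -> derivable F z 1) -> {within A, continuous F}.
Proof.
by move=> h; apply: continuous_in_subspaceT => z; rewrite inE => /h/derivable_continuous.
Qed.

Lemma closed_cmod_le (F : C -> C) (r : R) : continuous F -> closed [set z | cmod (F z) <= r].
Proof.
move=> cF; apply: (@preimage_closed _ _ (fun z => cmod (F z)) [set t | t <= r]).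
  by move=> z _; apply: continuous_comp; [exact: cF|exact: continuous_cmod].
exact: closed_le.
Qed.

Lemma open_cmod_lt (F : C -> C) (r : R) : continuous F -> open [set z | cmod (F z) < r].
Proof.
move=> cF; apply: (@open_comp _ _ (fun z => cmod (F z)) [set t | t < r]).
  by move=> z _; apply: continuous_comp; [exact: cF|exact: continuous_cmod].
exact: open_lt.
Qed.

Lemma compact_circle : compact [set w : C | cmod w = 1].
Proof.
apply: (@compact_cbounded _ _ 1); last by move=> z /= ->.
apply: (@preimage_closed _ _ (@cmod R) [set t | t = 1]); last exact: closed_eq.
by move=> z _; exact: continuous_cmod.
Qed.

Lemma continuous_subC (c : C) : continuous (fun z : C => z - c).
Proof.
by move=> z; apply: derivable_continuous; apply: derivableB;
  [exact: derivable_id|exact: derivable_cst].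
Qed.

Lemma expr_unbounded (t a M : R) : 1 < t -> (forall n, a * t ^+ n <= M) -> a <= 0.
Proof.
move=> t1 h; rewrite leNgt; apply/negP => a0.
have bern n : 1 + n%:R * (t - 1) <= t ^+ n.
  elim: n => [|n ih]; first by rewrite mul0r addr0 expr0.
  rewrite exprSr; have : (1 + n%:R * (t - 1)) * t <= t ^+ n * t by rewrite ler_wpM2r//; lra.
  apply: le_trans; rewrite -natr1.
  have : 0 <= n%:R * (t - 1) ^+ 2 by rewrite mulr_ge0// sqr_ge0.
  by nra.
have M0 : 0 <= M by apply: le_trans (h 0%N); rewrite expr0 mulr1 ltW.
have q0 : 0 <= M / (a * (t - 1)) by rewrite divr_ge0// mulr_ge0 ?ltW// subr_gt0.
have := archi_boundP q0; set n := Num.bound _ => hn.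
have := h n; apply/negP; rewrite -ltNge.
have at0 : 0 < a * (t - 1) by rewrite mulr_gt0// subr_gt0.
rewrite ltr_pdivrMr// in hn; apply: (lt_le_trans hn).
by rewrite mulrCA ler_pM2l//; have := bern n; lra.
Qed.

Lemma derivable_expn (k : C -> C) (z : C) n :
  derivable k z 1 -> derivable (fun w => k w ^+ n) z 1.
Proof.
move=> dk; elim: n => [|n ih]; first exact: (derivable_cst (1 : C)).
have -> : (fun w => k w ^+ n.+1) = (fun w => k w * k w ^+ n).
  by apply/funext => w; rewrite exprS.
exact: (derivableM dk ih).
Qed.

(* [k] is the inverse of the Blaschke factor of a slightly smaller disc vanishing at
   [a], so [F k^n] is bounded uniformly in [n] while [|k| > 1] inside. *)
Lemma identity_disc (F : C -> C) (c a : C) (r0 s : R) :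
  (forall w, cmod (w - c) < r0 -> derivable F w 1) ->
  0 < s -> cmod (a - c) < r0 -> (forall w, cmod (w - a) < s -> F w = 0) ->
  forall z, cmod (z - c) < r0 -> F z = 0.
Proof.
move=> dF s0 ac F0 z zc.
have [/F0//|sz] := ltP (cmod (z - a)) s.
(* A smaller disc with [a] and [z] still inside it, so that [F] is differentiable up to its
   boundary. *)
pose r := (Num.max (cmod (a - c)) (cmod (z - c)) + r0) / 2.
have [ar zr rr0] : [/\ cmod (a - c) < r, cmod (z - c) < r & r < r0].
  have : Num.max (cmod (a - c)) (cmod (z - c)) < r0 by rewrite gt_max ac.
  have : cmod (a - c) <= Num.max (cmod (a - c)) (cmod (z - c)) by rewrite le_max lexx.
  have : cmod (z - c) <= Num.max (cmod (a - c)) (cmod (z - c)) by rewrite le_max lexx orbT.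
  rewrite /r; set m := Num.max _ _ => *; split; lra.
clearbody r; have r00 : 0 < r by apply: le_lt_trans ar; exact: cmod_ge0.
(* [k] has its pole at [a]. The disc cut out lies where [F] vanishes, so the new boundary consists
   of zeros of [F w * k w ^+ n]. *)
pose Q := [set w : C | cmod (w - c) <= r /\ ~ cmod (w - a) < s / 2].
pose U := [set w : C | cmod (w - c) < r /\ ~ cmod (w - a) <= s / 2].
pose k (w : C) : C := (mkc (r ^+ 2) 0 - cconj (a - c) * (w - c)) * (mkc r 0 * (w - a))^-1.
have dk w : w != a -> derivable k w 1.
  move=> wa; apply: derivableM.
    apply: derivableB; first exact: derivable_cst.
    apply: derivableM; first exact: derivable_cst.
    by apply: derivableB; [exact: derivable_id|exact: derivable_cst].
  apply: (@derivableV _ _ (fun w => mkc r 0 * (w - a))).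
    by rewrite mulf_neq0 ?subr_eq0// -cmod_eq0 cmod_real normr_eq0 gt_eqF.
  apply: derivableM; first exact: derivable_cst.
  by apply: derivableB; [exact: derivable_id|exact: derivable_cst].
have cQ : compact Q.
  apply: (@compact_cbounded _ _ (r + cmod c)).
    apply: closedI; first by apply: closed_cmod_le; exact: continuous_subC.
    apply: open_closedC; apply: open_cmod_lt; exact: continuous_subC.
  by move=> w [wr _]; rewrite -(subrK c w) (le_trans (cmodD _ _))// lerD2r.
have Qd w : Q w -> derivable F w 1 by move=> [wr _]; apply: dF; apply: le_lt_trans rr0.
have Qa w : Q w -> w != a.
  by move=> [_ h]; apply/eqP => wa; apply: h; rewrite wa subrr cmod0 divr_gt0.
have [M M1 HM] := compact_cmod_bound cQ (derivable_within Qd).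
have cmk w : cmod (k w) = cmod (mkc (r ^+ 2) 0 - cconj (a - c) * (w - c)) / (r * cmod (w - a)).
  by rewrite /k cmodM cmodV cmodM cmod_real (gtr0_norm r00).
(* The identity behind Blaschke factors: it shows that [cmod (k w)] is 1 on the circle of radius [r]
   and exceeds 1 inside it, away from the pole. *)
have idk w : cmod (mkc (r ^+ 2) 0 - cconj (a - c) * (w - c)) ^+ 2 =
   (r * cmod (w - a)) ^+ 2 + (r ^+ 2 - cmod (w - c) ^+ 2) * (r ^+ 2 - cmod (a - c) ^+ 2).
  have -> : w - a = (w - c) - (a - c) by ring.
  rewrite exprMn !sqr_cmod /cconj !creimE. ring.
have dH n w : Q w -> derivable (fun w => F w * k w ^+ n) w 1.
  by move=> Qw; exact: (derivable_mulC (Qd w Qw) (derivable_expn (dk w (Qa w Qw)))).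
have bound n : cmod (F z) * cmod (k z) ^+ n <= M.
  rewrite -cmodX -cmodM.
  have M0 : 0 <= M by apply: le_trans M1.
  apply: (@max_principle _ Q U (fun w => F w * k w ^+ n) M cQ) => //.
  - by move=> w [h1 h2]; split; [exact: ltW|move=> /ltW].
  - apply: openI; first by apply: open_cmod_lt; exact: continuous_subC.
    by apply: closed_openC; apply: closed_cmod_le; exact: continuous_subC.
  - exact: (derivable_within (@dH n)).
  - by move=> w [h1 h2]; apply: (dH n w); split; [exact: ltW|move=> /ltW].
  - move=> w Qw nU; have [wr|wr] := ltP (cmod (w - c)) r.
      have ws : cmod (w - a) <= s / 2.
        by apply: contrapT => ws; apply: nU.
      by rewrite F0 ?mul0r ?cmod0// (le_lt_trans ws)//; lra.
    have wr' : cmod (w - c) = r by apply/eqP; rewrite eq_le wr; case: Qw => ->.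
    rewrite cmodM cmodX; suff -> : cmod (k w) = 1 by rewrite expr1n mulr1 HM.
    have wa : 0 < cmod (w - a) by rewrite lt_neqAle cmod_ge0 eq_sym cmod_eq0 subr_eq0 Qa.
    rewrite cmk; apply/eqP; rewrite -(@eqrXn2 _ 2)// ?divr_ge0 ?mulr_ge0 ?cmod_ge0 ?(ltW r00)//.
    rewrite expr_div_n idk wr' subrr mul0r addr0 divff ?expr1n//.
    by rewrite expf_neq0// mulf_neq0// gt_eqF.
  - by split; [exact: ltW|apply/negP; rewrite -leNgt; lra].
have kz : 1 < cmod (k z).
  have za : 0 < cmod (z - a) by apply: lt_le_trans sz.
  rewrite cmk ltr_pdivlMr ?mulr_gt0// mul1r.
  rewrite -(@ltr_pXn2r _ 2) ?nnegrE ?mulr_ge0 ?cmod_ge0 ?(ltW r00)// idk ltrDl.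
  by rewrite mulr_gt0// subr_gt0 ltr_pXn2r ?nnegrE ?cmod_ge0 ?(ltW r00).
apply/eqP; rewrite -cmod_eq0 eq_le cmod_ge0 andbT.
exact: (expr_unbounded kz bound).
Qed.

End HalfDisc.

(** * The reflected Poisson kernel of the half disc *)

Section HalfDiscUniqueness.
Variable R : realType.
Local Notation C := (Cplx R).

Definition half_disc : set C := [set z | cmod z <= 1 /\ 0 <= cim z].
Definition half_disc_int : set C := [set z | cmod z < 1 /\ 0 < cim z].

Lemma closed_im_ge0 : closed [set z : C | 0 <= cim z].
Proof.
apply: (@preimage_closed _ _ (@cim R) [set t | 0 <= t]); last exact: closed_ge.
by move=> z _; exact: continuous_cim.
Qed.

Lemma open_im_gt0 : open [set z : C | 0 < cim z].
Proof.
apply: (@open_comp _ _ (@cim R) [set t | 0 < t]); last exact: open_gt.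
by move=> z _; exact: continuous_cim.
Qed.

Lemma compact_half_disc : compact half_disc.
Proof.
apply: (@compact_cbounded _ _ 1); last by move=> z [].
apply: closedI; last exact: closed_im_ge0.
by apply: (@closed_cmod_le _ id) => z; exact: cvg_id.
Qed.

Lemma open_half_disc_int : open half_disc_int.
Proof.
apply: openI; last exact: open_im_gt0.
by apply: (@open_cmod_lt _ id) => z; exact: cvg_id.
Qed.

Lemma cinvE (z : C) : z^-1 =
  mkc (cre z / (cre z ^+ 2 + cim z ^+ 2)) (- (cim z / (cre z ^+ 2 + cim z ^+ 2))).
Proof. by case: z. Qed.

(* The real part of [half_disc_kernel s sg] is the Poisson kernel of the upper
   half plane with pole [s - i sg] minus its reflection in the unit circle: it
   vanishes on the unit circle and is nonnegative on the half disc. *)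
Definition half_disc_kernel (s sg : R) (z : C) : C :=
  mkc 0 (-1) * (- (z - mkc s (- sg))^-1 - z * (1 - mkc s sg * z)^-1).

(** With [z = x + i y] and the pole [p = s - i sg], these are [|z - p|^2] and [|1 - conj(p) z|^2];
    the second vanishes at the mirror image of [p] in the unit circle. *)
Let sqdist (s sg x y : R) := (x - s) ^+ 2 + (y + sg) ^+ 2.
Let sqdist' (s sg x y : R) := (1 - s * x + sg * y) ^+ 2 + (s * y + sg * x) ^+ 2.

Lemma re_half_disc_kernel s sg x y :
  cre (half_disc_kernel s sg (mkc x y)) =
  (y + sg) / sqdist s sg x y - (y + sg * (x ^+ 2 + y ^+ 2)) / sqdist' s sg x y.
Proof.
rewrite /half_disc_kernel !cinvE !creimE.
have -> : (x - s) ^+ 2 + (y - - sg) ^+ 2 = sqdist s sg x y by rewrite opprK.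
have -> : (1 - (s * x - sg * y)) ^+ 2 + (0 - (s * y + sg * x)) ^+ 2 = sqdist' s sg x y.
  by rewrite /sqdist'; ring.
move: (sqdist _ _ _ _)^-1 (sqdist' _ _ _ _)^-1 => A B; ring.
Qed.

(** Equality of the two denominators on the unit circle makes the real part of the kernel vanish
    there; the sign of the difference makes it nonnegative inside. *)
Lemma sqdistB s sg x y : sqdist' s sg x y - sqdist s sg x y =
  (1 - s ^+ 2 - sg ^+ 2) * (1 - x ^+ 2 - y ^+ 2).
Proof. by rewrite /sqdist' /sqdist; ring. Qed.

Section kernel.
Variables (s sg : R).
Hypotheses (s2 : - 2^-1 <= s <= 2^-1) (sg0 : 0 < sg) (sg2 : sg <= 2^-1).

(** Keeps the factor [1 - s ^+ 2 - sg ^+ 2] of [sqdistB] above 1/2, uniformly in the pole. *)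
Let ssg : s ^+ 2 + sg ^+ 2 <= 2^-1.
Proof.
have : s ^+ 2 <= 2^-1 ^+ 2 by move: s2 => /andP[? ?]; nra.
have : sg ^+ 2 <= 2^-1 ^+ 2 by move: sg0 sg2 => ? ?; nra.
lra.
Qed.

Let sqdist_gt0 x y : 0 <= y -> 0 < sqdist s sg x y.
Proof. by move=> y0; rewrite ltr_wpDl ?sqr_ge0// exprn_gt0// ltr_wpDl. Qed.

Let sqdist_le x y : x ^+ 2 + y ^+ 2 <= 1 -> sqdist s sg x y <= sqdist' s sg x y.
Proof.
move=> xy; rewrite -subr_ge0 sqdistB mulr_ge0//; have := ssg; lra.
Qed.

Lemma half_disc_kernel_poles z : half_disc z ->
  z - mkc s (- sg) != 0 /\ 1 - mkc s sg * z != 0.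
Proof.
move=> [z1 y0]; have h := sqdist_gt0 (cre z) y0.
have z2 : cre z ^+ 2 + cim z ^+ 2 <= 1 by rewrite -sqr_cmod exprn_ile1// cmod_ge0.
have h' := lt_le_trans h (sqdist_le z2).
split; apply/negP => /eqP e.
  move: h; have := congr1 (@cre R) e; have := congr1 (@cim R) e; rewrite !creimE /sqdist => e1 e2.
  by rewrite e2 -[sg]opprK e1 expr0n addr0 ltxx.
move: h'; have := congr1 (@cre R) e; have := congr1 (@cim R) e; rewrite !creimE /sqdist' => e1 e2.
have -> : 1 - s * cre z + sg * cim z = 0 by lra.
have -> : s * cim z + sg * cre z = 0 by lra.
by rewrite expr0n addr0 ltxx.
Qed.

Lemma derivable_half_disc_kernel z : half_disc z -> derivable (half_disc_kernel s sg) z 1.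
Proof.
move=> /half_disc_kernel_poles[p1 p2].
apply: derivable_mulC; first exact: derivable_cst.
apply: derivable_subC.
  by apply: derivable_oppC; apply: derivable_invC.
apply: derivable_mulC; first exact: derivable_id.
by apply: derivable_invC.
Qed.

Lemma half_disc_kernel_circle z : half_disc z -> cmod z = 1 ->
  cre (half_disc_kernel s sg z) = 0.
Proof.
move=> [_ y0] z1; have e : cre z ^+ 2 + cim z ^+ 2 = 1 by rewrite -sqr_cmod z1 expr1n.
rewrite -(mkc_eta z) re_half_disc_kernel e mulr1.
have := sqdistB s sg (cre z) (cim z).
have -> : 1 - cre z ^+ 2 - cim z ^+ 2 = 0 by lra.
rewrite mulr0.
by move=> /eqP; rewrite subr_eq0 => /eqP ->; rewrite subrr.
Qed.

Lemma half_disc_kernel_diameter x : -1 <= x <= 1 ->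
  cre (half_disc_kernel s sg (mkc x 0)) <= sg / ((x - s) ^+ 2 + sg ^+ 2).
Proof.
move=> hx; rewrite re_half_disc_kernel /sqdist !add0r gerBl divr_ge0//.
  by rewrite mulr_ge0 ?(ltW sg0)// addr_ge0// sqr_ge0.
by rewrite addr_ge0// sqr_ge0.
Qed.

(** Uniform in [s] and [sg], so it survives refinement of the grid. With [A] and [B] the two
    denominators, [B - A] is at least half of [1 - |z|^2] and [A * B] is at most 16, whence 32; the
    remaining term is nonnegative because [A <= B] and [|z| < 1]. *)
Lemma half_disc_kernel_interior z : half_disc_int z ->
  cim z * (1 - cmod z ^+ 2) / 32 <= cre (half_disc_kernel s sg z).
Proof.
move=> [z1 y0]; rewrite -{3}(mkc_eta z) re_half_disc_kernel sqr_cmod.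
have z2 : cre z ^+ 2 + cim z ^+ 2 < 1 by rewrite -sqr_cmod exprn_ilt1// cmod_ge0.
move: (cre z) (cim z) y0 z2 => x y y0 z2.
have A0 := sqdist_gt0 x (ltW y0); have AB := sqdist_le (ltW z2).
have B0 := lt_le_trans A0 AB.
have BA := sqdistB s sg x y.
have B4 : sqdist' s sg x y <= 4.
  rewrite /sqdist'.
  have -> : (1 - s * x + sg * y) ^+ 2 + (s * y + sg * x) ^+ 2 =
     1 - 2 * (s * x - sg * y) + (s ^+ 2 + sg ^+ 2) * (x ^+ 2 + y ^+ 2) by ring.
  have h1 : (s ^+ 2 + sg ^+ 2) * (x ^+ 2 + y ^+ 2) <= 2^-1 * 1.
    by rewrite ler_pM ?addr_ge0 ?sqr_ge0// ltW.
  have h2 : - (2 * (s * x - sg * y)) <= s ^+ 2 + sg ^+ 2 + (x ^+ 2 + y ^+ 2).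
    have -> : s ^+ 2 + sg ^+ 2 + (x ^+ 2 + y ^+ 2) =
      (s + x) ^+ 2 + (sg - y) ^+ 2 - (2 * (s * x - sg * y)) by ring.
    by rewrite lerDr addr_ge0// sqr_ge0.
  have := ssg; lra.
move: (sqdist s sg x y) (sqdist' s sg x y) A0 AB B0 BA B4 => A B A0 AB B0 BA B4.
have -> : (y + sg) / A - (y + sg * (x ^+ 2 + y ^+ 2)) / B =
  y * (B - A) / (A * B) + sg * (A^-1 - (x ^+ 2 + y ^+ 2) / B).
  by field; rewrite !gt_eqF.
have t2 : 0 <= sg * (A^-1 - (x ^+ 2 + y ^+ 2) / B).
  rewrite mulr_ge0 ?(ltW sg0)// subr_ge0 ler_pdivrMr// mulrC.
  by rewrite (le_trans (ltW z2))// ler_pdivlMr// mul1r.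
have t1 : y * (1 - (x ^+ 2 + y ^+ 2)) / 32 <= y * (B - A) / (A * B).
  rewrite BA ler_pdivlMr ?mulr_gt0//.
  have AB16 : A * B <= 4 * 4 by rewrite ler_pM ?(ltW A0) ?(ltW B0)// (le_trans AB).
  have yr : 0 <= y * (1 - (x ^+ 2 + y ^+ 2)) by rewrite mulr_ge0 ?(ltW y0)// subr_ge0 ltW.
  have h : y * (1 - (x ^+ 2 + y ^+ 2)) * (A * B) <= y * (1 - (x ^+ 2 + y ^+ 2)) * 16.
    by rewrite ler_wpM2l// (le_trans AB16)//; lra.
  have h' : y * (1 - (x ^+ 2 + y ^+ 2)) * 2^-1 <= y * (1 - (x ^+ 2 + y ^+ 2)) * (1 - s ^+ 2 - sg ^+ 2).
    by rewrite ler_wpM2l//; have := ssg; lra.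
  have -> : y * ((1 - s ^+ 2 - sg ^+ 2) * (1 - x ^+ 2 - y ^+ 2)) =
     y * (1 - (x ^+ 2 + y ^+ 2)) * (1 - s ^+ 2 - sg ^+ 2) by ring.
  lra.
lra.
Qed.

End kernel.

(* Telescoping with [y / (sg + |y|)], whose increments dominate the summands. *)
Lemma poisson_sum_bound (n : nat) (sg x s0 : R) : (0 < n)%N -> n%:R^-1 <= sg ->
  \sum_(k < n) n%:R^-1 * (sg / ((x - (s0 + k%:R / n%:R)) ^+ 2 + sg ^+ 2)) <= 16.
Proof.
move=> n0 dsg; set d := n%:R^-1 in dsg *.
have d0 : 0 < d by rewrite invr_gt0 ltr0n.
have sg0 : 0 < sg by apply: lt_le_trans dsg.
pose G (y : R) := y / (sg + `|y|).
have G1 y : `|G y| <= 1.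
  have p : 0 < sg + `|y| by rewrite ltr_pwDl.
  by rewrite normrM normfV (gtr0_norm p) ler_pdivrMr// mul1r lerDr ltW.
have inc y : d * (sg / (y ^+ 2 + sg ^+ 2)) <= 8 * (G (y + d) - G y).
  clearbody d.
  have q0 : 0 < y ^+ 2 + sg ^+ 2 by rewrite ltr_wpDl ?sqr_ge0// exprn_gt0.
  rewrite mulrA ler_pdivrMr//.
  have [y0|y0] := leP 0 y.
    rewrite /G !ger0_norm//; last by rewrite addr_ge0// ltW.
    have -> : (y + d) / (sg + (y + d)) - y / (sg + y) = sg * d / ((sg + y) * (sg + (y + d))).
      by field; rewrite !gt_eqF//; lra.
    have p : 0 < (sg + y) * (sg + (y + d)) by rewrite mulr_gt0//; lra.
    rewrite mulrA -mulrAC ler_pdivlMr//.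
    have : (sg + y) * (sg + (y + d)) <= 8 * (y ^+ 2 + sg ^+ 2) by nra.
    move=> h; have := ler_wpM2l (ltW (mulr_gt0 d0 sg0)) h; lra.
  have [yd|yd] := leP (y + d) 0.
    rewrite /G (ler0_norm yd) (ltr0_norm y0).
    have -> : (y + d) / (sg - (y + d)) - y / (sg - y) = sg * d / ((sg - y) * (sg - (y + d))).
      by field; rewrite !gt_eqF//; lra.
    have p : 0 < (sg - y) * (sg - (y + d)) by rewrite mulr_gt0//; lra.
    rewrite mulrA -mulrAC ler_pdivlMr//.
    have : (sg - y) * (sg - (y + d)) <= 8 * (y ^+ 2 + sg ^+ 2) by nra.
    move=> h; have := ler_wpM2l (ltW (mulr_gt0 d0 sg0)) h; lra.
  (* Here [- y] and [y + d] are both below [d <= sg], so both denominators are at most [2 * sg]. *)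
  rewrite /G (gtr0_norm yd) (ltr0_norm y0).
  have h1 : (y + d) / (2 * sg) <= (y + d) / (sg + (y + d)).
    by rewrite ler_pM2l// lef_pV2 ?posrE; lra.
  have h2 : - y / (2 * sg) <= - y / (sg - y).
    by rewrite ler_pM2l ?oppr_gt0// lef_pV2 ?posrE; lra.
  have h3 : d / (2 * sg) <= (y + d) / (sg + (y + d)) - y / (sg - y).
    have -> : d / (2 * sg) = (y + d) / (2 * sg) + - y / (2 * sg) by field; rewrite gt_eqF.
    rewrite -mulNr; lra.
  have h4 : d / (2 * sg) * sg ^+ 2 = d * sg / 2 by field; rewrite gt_eqF.
  have h5 : sg ^+ 2 <= y ^+ 2 + sg ^+ 2 by rewrite lerDr sqr_ge0.
  have h6 : 0 < d / (2 * sg) by rewrite divr_gt0// mulr_gt0.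
  have h7 := ler_pM (ltW h6) (sqr_ge0 sg) h3 h5.
  have := mulr_gt0 d0 sg0; lra.
pose y (k : nat) := s0 + k%:R * d - x.
have yS k : y k.+1 = y k + d by rewrite /y -natr1; ring.
apply: (@le_trans _ _ (\sum_(k < n) 8 * (G (y k.+1) - G (y k)))).
  apply: ler_sum => k _; rewrite yS; apply: le_trans (inc (y k)).
  by rewrite /y -sqrrN opprB.
(* The telescoped sum is 8 times a difference of two values of [G], each of modulus at most 1; hence
   16. *)
rewrite -mulr_sumr -(big_mkord xpredT (fun k => G (y k.+1) - G (y k))) telescope_sumr//.
have := G1 (y n); have := G1 (y 0%N); rewrite !ler_norml => /andP[? ?] /andP[? ?]; lra.
Qed.

End HalfDiscUniqueness.

(** * Uniqueness on the half disc *)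

Section HalfDiscUniquenessTheorem.
Variable R : realType.
Local Notation C := (Cplx R).

Lemma compact_uniformly_continuous (Q : set C) (G : C -> C) :
  compact Q -> {within Q, continuous G} -> forall e : R, 0 < e ->
  exists2 d : R, 0 < d & forall z w, Q z -> Q w -> cmod (w - z) < d -> cmod (G w - G z) < e.
Proof.
move=> /compact_near_coveringP/near_covering_withinP cQ /within_cmodP cG e e0.
have := cQ _ (0 : R)^'+ (fun d z => forall w, Q w -> cmod (w - z) < d -> cmod (G w - G z) < e) _.
case.
  move=> z Qz; have e20 : 0 < e / 2 by rewrite divr_gt0.
  have [d d0 Hd] := cG z Qz _ e20.
  exists ([set z' | cmod (z' - z) < d / 2], [set t | t < d / 2]).
    split=> /=; first by apply/nbhs_cmodP; exists (d / 2); rewrite ?divr_gt0.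
    by apply: nbhs_right_lt; rewrite divr_gt0.
  move=> [z' t] [/= z'z td] Qz' w Qw wz'.
  have h1 : cmod (G z' - G z) < e / 2 by apply: Hd => //; lra.
  have h2 : cmod (G w - G z) < e / 2.
    apply: Hd => //; apply: le_lt_trans (cmod_triangle w z' z) _; lra.
  apply: le_lt_trans (cmod_triangle _ (G z) _) _; rewrite (cmod_distC (G z)); lra.
move=> d /= d0 H; exists (d / 2); first by rewrite divr_gt0.
move=> z w Qz Qw wz; apply: (H (d / 2)) => //=; last by rewrite divr_gt0.
by rewrite sub0r normrN gtr0_norm ?divr_gt0//; lra.
Qed.

Lemma derivable_sumC (h : nat -> C -> C) (z : C) (n : nat) :
  (forall k, (k < n)%N -> derivable (h k) z 1) ->
  derivable (fun w => \sum_(k < n) h k w) z 1.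
Proof.
elim: n => [|n ih] hk.
  have -> : (fun w => \sum_(k < 0) h k w) = (fun=> 0) by apply/funext => w; rewrite big_ord0.
  exact: derivable_cst.
have -> : (fun w => \sum_(k < n.+1) h k w) = (fun w => \sum_(k < n) h k w + h n w).
  by apply/funext => w; rewrite big_ord_recr.
apply: (derivable_addC (f := fun w => \sum_(k < n) h k w)).
  by apply: ih => k kn; apply: hk; apply: ltnW.
exact: hk.
Qed.

Lemma cre_sum (n : nat) (h : nat -> C) : cre (\sum_(k < n) h k) = \sum_(k < n) cre (h k).
Proof. exact: (big_morph (@cre R) (@creD R) (cre0 R)). Qed.

Definition grid (n k : nat) : R := - 2^-1 + k%:R / n%:R.

Definition cell_hit (n : nat) (X : set R) (k : nat) : bool :=
  `[< exists2 x, X x & grid n k <= x <= grid n k.+1 >].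

(** A discrete outer content of [X] in [[-1/2, 1/2]] at mesh [1/n], meaningful for an arbitrary set;
    a lower bound uniform in [n] expresses that [X] is not small. *)
Definition hit_mass (n : nat) (X : set R) : R := \sum_(k < n) (cell_hit n X k)%:R / n%:R.

Lemma hit_mass_le1 n X : (0 < n)%N -> hit_mass n X <= 1.
Proof.
move=> n0; apply: (@le_trans _ _ (\sum_(k < n) 1 / n%:R)).
  by apply: ler_sum => k _; rewrite ler_wpM2r ?invr_ge0 ?ler0n// lern1 leq_b1.
by rewrite sumr_const card_ord -[(_ / _) *+ _]mulr_natr div1r mulVf// pnatr_eq0 -lt0n.
Qed.

(** Up to normalisation and reflection, a Riemann sum for the Poisson integral of the indicator of
    [X]. The poles lie at depth [sg] below the diameter, which makes [V] differentiable on the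
    closed half disc. *)
Let V (n : nat) (sg : R) (X : set R) (z : C) : C :=
  \sum_(k < n) mkc ((cell_hit n X k)%:R / n%:R) 0 * half_disc_kernel (grid n k) sg z.

Let re_V n sg X z : cre (V n sg X z) =
  \sum_(k < n) (cell_hit n X k)%:R / n%:R * cre (half_disc_kernel (grid n k) sg z).
Proof.
rewrite /V (cre_sum _ (fun k => mkc ((cell_hit n X k)%:R / n%:R) 0 * half_disc_kernel (grid n k) sg z)).
by apply: eq_bigr => k _; rewrite creM cre_mkc cim_mkc mul0r subr0.
Qed.

Lemma grid_bounds n k : (0 < n)%N -> (k <= n)%N -> - 2^-1 <= grid n k <= 2^-1.
Proof.
move=> n0 kn; rewrite /grid.
have h0 : 0 <= k%:R / n%:R :> R by rewrite divr_ge0.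
have h1 : k%:R / n%:R <= 1 :> R by rewrite ler_pdivrMr ?ltr0n// mul1r ler_nat.
lra.
Qed.

Section estimates.
Variables (n : nat) (sg : R) (X : set R).
Hypotheses (n0 : (0 < n)%N) (sg0 : 0 < sg) (sg2 : sg <= 2^-1).

Let w_ge0 k : 0 <= (cell_hit n X k)%:R / n%:R :> R.
Proof. by rewrite divr_ge0. Qed.

Let gb (k : 'I_n) : - 2^-1 <= grid n k <= 2^-1.
Proof. by apply: grid_bounds => //; apply: ltnW. Qed.

Let derivable_V z : half_disc z -> derivable (V n sg X) z 1.
Proof.
move=> Qz; apply: (@derivable_sumC (fun k z => mkc ((cell_hit n X k)%:R / n%:R) 0 * half_disc_kernel (grid n k) sg z)).
move=> k kn; apply: derivable_mulC; first exact: derivable_cst.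
apply: derivable_half_disc_kernel => //; exact: (gb (Ordinal kn)).
Qed.

Let V_circle z : half_disc z -> cmod z = 1 -> cre (V n sg X z) = 0.
Proof.
by move=> Qz z1; rewrite re_V big1// => k _; rewrite half_disc_kernel_circle// mulr0.
Qed.

Let V_interior z : half_disc_int z ->
  cim z * (1 - cmod z ^+ 2) / 32 * hit_mass n X <= cre (V n sg X z).
Proof.
move=> Uz; rewrite re_V mulr_sumr ler_sum// => k _; rewrite mulrC ler_wpM2l//.
exact: half_disc_kernel_interior.
Qed.

Let V_diameter x : -1 <= x <= 1 -> n%:R^-1 <= sg -> cre (V n sg X (mkc x 0)) <= 16.
Proof.
move=> hx ns; rewrite re_V.
apply: le_trans (@poisson_sum_bound R n sg x (- 2^-1) n0 ns).
apply: ler_sum => k _.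
have p : 0 <= sg / ((x - grid n k) ^+ 2 + sg ^+ 2).
  by rewrite divr_ge0 ?(ltW sg0)// addr_ge0// sqr_ge0.
apply: (@le_trans _ _ ((cell_hit n X k)%:R / n%:R * (sg / ((x - grid n k) ^+ 2 + sg ^+ 2)))).
  by rewrite ler_wpM2l// half_disc_kernel_diameter.
by rewrite ler_wpM2r// ler_piMl ?invr_ge0// lern1 leq_b1.
Qed.

Let V_far x d : 0 < d -> -1 <= x <= 1 -> n%:R^-1 <= d ->
  (forall x', X x' -> 2 * d <= `|x - x'|) -> cre (V n sg X (mkc x 0)) <= sg / d ^+ 2.
Proof.
move=> d0 hx nd far; rewrite re_V.
apply: (@le_trans _ _ (\sum_(k < n) (cell_hit n X k)%:R / n%:R * (sg / d ^+ 2))); last first.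
  rewrite -mulr_suml -[leRHS]mul1r ler_wpM2r ?hit_mass_le1//.
  by rewrite divr_ge0 ?(ltW sg0)// sqr_ge0.
apply: ler_sum => k _; case: (boolP (cell_hit n X k)) => [/asboolP[x' Xx' hx']|_]; last first.
  by rewrite !mul0r.
rewrite ler_wpM2l ?divr_ge0//.
apply: le_trans; first by apply: half_disc_kernel_diameter.
(* The left end of a hit cell is within [1/n <= d] of a point of [X], which is itself at distance at
   least [2 * d] from [x]. *)
have h : d <= `|x - grid n k|.
  have := far x' Xx'; have := ler_distD (grid n k) x x'.
  have : `|grid n k - x'| <= d.
    have E : k.+1%:R = k%:R + 1 :> R by rewrite natr1.
    move: hx'; rewrite /grid E mulrDl mul1r => /andP[a b].
    by rewrite distrC ler_norml; lra.
  lra.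
have h2 : d ^+ 2 <= (x - grid n k) ^+ 2 + sg ^+ 2.
  have : d ^+ 2 <= (x - grid n k) ^+ 2.
    by rewrite -[leRHS]real_normK ?num_real// ler_pXn2r ?nnegrE// ltW.
  by have := sqr_ge0 sg; lra.
rewrite ler_wpM2l ?(ltW sg0)// lef_pV2// posrE ?exprn_gt0//.
by apply: lt_le_trans h2; rewrite exprn_gt0.
Qed.

(** The maximum principle for [G exp (N V)] with three boundary pieces. On the circle the
    exponential has modulus 1; on the diameter near [X] the bound [exp (-16 N)] for [G] absorbs the
    bound 16 for the real part of [V]; far from [X] that real part is at most [sg / d ^+ 2], and the
    exponential at most [exp 1]. *)
Lemma half_disc_estimate (G : C -> C) (M N d m : R) z0 :
  {within @half_disc R, continuous G} ->
  (forall z, half_disc_int z -> derivable G z 1) ->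
  1 <= M -> (forall z, half_disc z -> cmod (G z) <= M) ->
  0 < N -> 0 < d -> n%:R^-1 <= sg -> n%:R^-1 <= d -> sg / d ^+ 2 * N <= 1 ->
  (forall x x', -1 <= x <= 1 -> X x' -> `|x - x'| < 2 * d ->
     cmod (G (mkc x 0)) <= expR (- (16 * N))) ->
  m <= hit_mass n X -> half_disc_int z0 ->
  cmod (G z0) * expR (N * (cim z0 * (1 - cmod z0 ^+ 2) / 32 * m)) <= M * expR 1.
Proof.
move=> cG dG M1 GM N0 d0 nsg nd sgd near_zero hm Uz0.
have Qz0 : half_disc z0 by case: Uz0 => *; split; exact: ltW.
have M0 : 0 <= M by apply: le_trans M1.
pose E z := cexp (mkc N 0 * V n sg X z).
have dE z : half_disc z -> derivable E z 1.
  move=> Qz; apply: (@derivable_compC _ (fun z => mkc N 0 * V n sg X z) (@cexp R)).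
    by apply: derivable_mulC; [exact: derivable_cst|exact: derivable_V].
  exact: derivable_cexp.
have cE z : cmod (E z) = expR (N * cre (V n sg X z)).
  by rewrite cmod_cexp creM cre_mkc cim_mkc mul0r subr0.
have e1 : 1 <= expR 1 :> R by rewrite -expR0 ler_expR.
have := @max_principle _ (@half_disc R) (@half_disc_int R) (fun z => G z * E z) (M * expR 1)
  (@compact_half_disc R).
move=> /(_ _ _ _ _ _ _ z0 Qz0) H.
have h : cmod (G z0 * E z0) <= M * expR 1.
  apply: H.
  - by move=> z [? ?]; split; exact: ltW.
  - exact: open_half_disc_int.
  - by move=> z; apply: cvgM; [exact: cG|exact: (derivable_within dE)].
  - move=> z Uz; apply: (derivable_mulC (dG z Uz)); apply: dE.
    by case: Uz => *; split; exact: ltW.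
  - by rewrite mulr_ge0// expR_ge0.
  move=> z Qz nU; rewrite cmodM cE.
  have [z1|z1] := eqVneq (cmod z) 1.
    by rewrite V_circle// mulr0 expR0 ler_pM ?cmod_ge0// GM.
  have zlt : cmod z < 1 by rewrite lt_neqAle z1; case: Qz.
  have z0' : cim z = 0.
    apply/eqP; rewrite eq_le; case: (Qz) => _ ->; rewrite andbT leNgt.
    by apply/negP => h; apply: nU.
  have zE : z = mkc (cre z) 0 by rewrite -z0' mkc_eta.
  have hx : -1 <= cre z <= 1 by rewrite -ler_norml (le_trans (cre_le_cmod _))// ltW.
  have [[x' Xx' xx']|far] := pselect (exists2 x', X x' & `|cre z - x'| < 2 * d).
    have g := near_zero _ _ hx Xx' xx'; rewrite -zE in g.
    have v := V_diameter hx nsg; rewrite -zE in v.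
    apply: (@le_trans _ _ (expR (- (16 * N)) * expR (N * 16))).
      by rewrite ler_pM ?cmod_ge0 ?expR_ge0// ler_expR ler_pM2l.
    rewrite -expRD (mulrC N) addNr expR0.
    by rewrite -[leLHS]mul1r ler_pM.
  have v := @V_far (cre z) d d0 hx nd _; rewrite -zE in v.
  rewrite ler_pM ?cmod_ge0 ?expR_ge0 ?GM// ler_expR.
  apply: le_trans sgd; rewrite mulrC ler_pM2r//; apply: v => x' Xx'.
  by rewrite leNgt; apply/negP => h; apply: far; exists x'.
apply: le_trans h; rewrite cmodM cE ler_wpM2l ?cmod_ge0// ler_expR ler_pM2l//.
apply: le_trans (V_interior Uz0); rewrite ler_wpM2l//.
case: Uz0 => z1 y0; rewrite divr_ge0// mulr_ge0 ?(ltW y0)// subr_ge0.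
by rewrite exprn_ile1 ?cmod_ge0// ltW.
Qed.

End estimates.

(** [N] is fixed before everything else: uniform continuity then yields [d], next [sg] is taken at
    most [d ^+ 2 / N], and finally [1/n] below both. The exponent [q] involves only [z0] and [m], so
    [|G z0| exp (N q)] stays bounded as [N] grows. *)
Theorem half_disc_uniqueness (G : C -> C) (X : set R) (m : R) :
  {within @half_disc R, continuous G} ->
  (forall z, half_disc_int z -> derivable G z 1) ->
  (forall x, X x -> - 2^-1 <= x <= 2^-1 /\ G (mkc x 0) = 0) ->
  0 < m -> (forall n, (0 < n)%N -> m <= hit_mass n X) ->
  forall z, half_disc_int z -> G z = 0.
Proof.
move=> cG dG GX m0 hm z0 Uz0.
have [M M1 GM] := compact_cmod_bound (@compact_half_disc R) cG.
pose q := cim z0 * (1 - cmod z0 ^+ 2) / 32 * m.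
have q0 : 0 < q.
  by case: Uz0 => z1 y0; rewrite !mulr_gt0// subr_gt0 exprn_ilt1// cmod_ge0.
suff key N : 0 < N -> cmod (G z0) * expR (N * q) <= M * expR 1.
  apply/eqP; rewrite -cmod_eq0 eq_le cmod_ge0 andbT.
  apply: (@expr_unbounded R (expR q) _ (M * expR 1)); first by rewrite -expR0 ltr_expR.
  case=> [|n]; last by rewrite -expRM_natl -natr1; apply: key; rewrite natr1 ltr0n.
  rewrite expr0 mulr1; apply: le_trans (key 1 ltr01).
  by rewrite mul1r ler_peMr ?cmod_ge0// -expR0 ler_expR ltW.
move=> N0.
have [d0 d00 Hd] := compact_uniformly_continuous (@compact_half_disc R) cG (expR_gt0 (- (16 * N))).
pose d := d0 / 2; have dd : 0 < d by rewrite divr_gt0.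
have d20 : 0 < d ^+ 2 / N by rewrite divr_gt0// exprn_gt0.
pose sg := Num.min 2^-1 (d ^+ 2 / N).
have sg0 : 0 < sg by rewrite lt_min d20 invr_gt0 ltr0n.
have sg2 : sg <= 2^-1 by rewrite ge_min lexx.
have sgd : sg <= d ^+ 2 / N by rewrite ge_min lexx orbT.
clearbody sg.
have [n n0 [ns nd]] : exists2 n, (0 < n)%N & n%:R^-1 <= sg /\ n%:R^-1 <= d.
  have a0 : 0 <= sg^-1 + d^-1 by rewrite addr_ge0// invr_ge0 ltW.
  have := archi_boundP a0; set n := Num.bound _ => hn.
  have hn0 : 0 < n%:R :> R by apply: le_lt_trans hn.
  exists n; first by rewrite ltr0n in hn0.
  have i1 : 0 <= sg^-1 by rewrite invr_ge0 ltW.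
  have i2 : 0 <= d^-1 by rewrite invr_ge0 ltW.
  by split; rewrite -[leRHS]invrK lef_pV2 ?posrE ?invr_gt0//; lra.
apply: (@half_disc_estimate n sg X n0 sg0 sg2 G M N d m z0) => //; last exact: hm.
  by rewrite mulrAC ler_pdivrMr ?exprn_gt0// mul1r -ler_pdivlMr.
move=> x x' hx Xx' xx'; have [hx' Gx'] := GX x' Xx'.
rewrite -[G (mkc x 0)]subr0 -Gx' ltW//; apply: Hd.
- by split; rewrite ?cmod_real ?cim_mkc// ler_norml; lra.
- by split; rewrite ?cmod_real ?cim_mkc// ler_norml; lra.
- by rewrite mkcN mkcD oppr0 addr0 cmod_real; apply: lt_le_trans xx' _; rewrite /d; lra.
Qed.

End HalfDiscUniquenessTheorem.

(** * Arcs and outer content on the circle *)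

Section Arcs.
Variable R : realType.
Local Notation C := (Cplx R).

Lemma expi0 : expi (0 : R) = 1.
Proof. by rewrite expiE cexp0. Qed.

Lemma expiN (t : R) : expi (- t) * expi t = 1.
Proof. by rewrite -expiD addNr expi0. Qed.

Lemma expi2pi (t : R) : expi (t + 2 * pi) = expi t.
Proof. by rewrite !expiE -(cexp2pi (mkc 0 t)) mkcD addr0. Qed.

Lemma cos_lt1 (u : R) : 0 < u < 2 * pi -> cos u < 1.
Proof.
move=> /andP[u0 u2]; have -> : u = (u / 2) *+ 2 by rewrite -mulr_natr divfK.
rewrite cos_mulr2n cos2sin2.
have : 0 < sin (u / 2) by apply: sin_gt0_pi; apply/andP; split; lra.
move=> s0; have := exprn_gt0 2 s0; rewrite mulr2n; lra.
Qed.

Lemma expi_inj (s t : R) : `|s - t| < 2 * pi -> expi s = expi t -> s = t.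
Proof.
move=> st e; apply/eqP; rewrite -subr_eq0; apply/negP => /negP d0.
have : expi (s - t) = 1 by rewrite expiD e mulrC expiN.
move=> /(congr1 (@cre R)) /=; rewrite /cre /= => c1.
have := @cos_lt1 `|s - t|; rewrite normr_gt0 d0 st cos_norm c1 ltxx.
by move=> /(_ isT).
Qed.

Lemma expi_surj (w : C) : cmod w = 1 -> exists2 t : R, 0 <= t < 2 * pi & w = expi t.
Proof.
move=> w1; have e : cre w ^+ 2 + cim w ^+ 2 = 1 by rewrite -sqr_cmod w1 expr1n.
have pi0 := @pi_gt0 R.
have hr : -1 <= cre w <= 1 by rewrite -ler_norml -w1 cre_le_cmod.
have hc : cos (acos (cre w)) = cre w by apply: acosK; rewrite in_itv.
have hs : sin (acos (cre w)) = `|cim w|.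
  by rewrite sin_acos// -sqrtr_sqr; congr Num.sqrt; lra.
have a0 := acos_ge0 hr; have api := acos_lepi hr.
have [i0|i0] := leP 0 (cim w).
  exists (acos (cre w)); first by rewrite a0/=; lra.
  by apply: mkc_inj; rewrite /cre /cim /= ?hc ?hs ?ger0_norm.
exists (2 * pi - acos (cre w)).
  have : acos (cre w) != 0.
    by apply/eqP => h; move: hs; rewrite h sin0 => /esym/eqP; rewrite normr_eq0 => /eqP; lra.
  by move=> an0; rewrite subr_ge0 ltrBlDr ltrDl lt_neqAle eq_sym an0 a0 andbT; lra.
rewrite addrC expi2pi; apply: mkc_inj; rewrite /cre /cim /= ?cosN ?sinN ?hc ?hs//.
by rewrite ltr0_norm// opprK.
Qed.

Lemma expi_surj_from (a : R) (w : C) : cmod w = 1 -> exists2 t : R, a <= t < a + 2 * pi & w = expi t.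
Proof.
move=> w1; have [|t ht e] := @expi_surj (w * expi (- a)).
  by rewrite cmodM cmod_expi mulr1.
exists (t + a); first by lra.
by rewrite expiD -e -mulrA expiN mulr1.
Qed.

(* Relatively open arc, for [a <= b <= a + 2 pi], described through its complement. *)
Definition open_arc (a b : R) : set C :=
  [set w | cmod w = 1 /\ ~ exists2 t, b <= t <= a + 2 * pi & w = expi t].

Lemma open_arc_expi (a b t : R) : b <= a + 2 * pi -> a < t < b -> open_arc a b (expi t).
Proof.
move=> ab /andP[at1 tb]; split; first exact: cmod_expi.
move=> [s /andP[bs sa] /expi_inj]; rewrite ltr_norml => h.
have : t = s by apply: h; lra.
lra.
Qed.

Lemma open_arcP (a b : R) (w : C) : open_arc a b w -> exists2 t, a <= t <= b & w = expi t.
Proof.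
move=> [w1 h]; have [t /andP[t1 t2] e] := expi_surj_from a w1.
exists t => //; rewrite t1 leNgt; apply/negP => bt; apply: h; exists t => //.
by rewrite !ltW.
Qed.

Definition arcs_len (s : seq (R * R)) : R := \sum_(p <- s) (p.2 - p.1).

Definition arcs_cover (s : seq (R * R)) (E : set C) : Prop :=
  (forall p, p \in s -> p.1 <= p.2 <= p.1 + 2 * pi) /\
  (forall w, E w -> exists2 p, p \in s & open_arc p.1 p.2 w).

(** Outer content at least [d]. Covers are finite and by open arcs so that, for slices of a closed
    set, failure of thickness is witnessed by a cover that also serves nearby slices. *)
Definition thick (d : R) (E : set C) : Prop := forall s, arcs_cover s E -> d <= arcs_len s.

Lemma thick_nonempty d (E : set C) : 0 < d -> thick d E -> exists w, E w.
Proof.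
move=> d0 tE; apply: contrapT => h; have := tE [::]; rewrite /arcs_len big_nil.
move=> H; suff : d <= 0 by lra.
by apply: H; split => // w Ew; exfalso; apply: h; exists w.
Qed.

(** Subadditivity: covers of the [N] pieces, each shorter than [d / N], would concatenate to a cover
    of [E] shorter than [d]. *)
Lemma thick_pigeonhole (d : R) (E : set C) (N : nat) (F : nat -> set C) :
  (0 < N)%N -> (forall w, E w -> exists2 k, (k < N)%N & F k w) -> thick d E ->
  exists2 k, (k < N)%N & thick (d / N%:R) (E `&` F k).
Proof.
move=> N0 EF tE; apply: contrapT => H.
have hk k : exists s, (k < N)%N -> arcs_cover s (E `&` F k) /\ arcs_len s < d / N%:R.
  have [kN|kN] := boolP (k < N)%N; last by exists [::].
  have : ~ thick (d / N%:R) (E `&` F k) by move=> t; apply: H; exists k.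
  move=> /existsNP[s /not_implyP[cs /negP]]; rewrite -ltNge => ls; by exists s.
pose s k := projT1 (cid (hk k)).
have sP k : (k < N)%N -> arcs_cover (s k) (E `&` F k) /\ arcs_len (s k) < d / N%:R.
  by rewrite /s; case: cid => /= ? h; apply: h.
have := tE (flatten [seq s k | k <- iota 0 N]).
have -> : arcs_len (flatten [seq s k | k <- iota 0 N]) = \sum_(0 <= k < N) arcs_len (s k).
  by rewrite /arcs_len big_flatten /= big_map /index_iota subn0.
move=> h; have : d <= \sum_(0 <= k < N) arcs_len (s k).
  apply: h; split.
    move=> p /flattenP[l /mapP[k]]; rewrite mem_iota => /andP[_ kN] -> pk.
    by have [[+ _] _] := sP k kN; apply.
  move=> w Ew; have [k kN Fk] := EF w Ew; have [[_ c] _] := sP k kN.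
  have [|p pk pw] := c w; first by split.
  by exists p => //; apply/flattenP; exists (s k) => //; apply/mapP; exists k; rewrite ?mem_iota.
apply/negP; rewrite -ltNge.
have -> : d = \sum_(0 <= k < N) d / N%:R.
  by rewrite sumr_const_nat subn0 -[(_ / _) *+ _]mulr_natr divfK// pnatr_eq0 -lt0n.
rewrite !big_mkord; apply: ltr_sum; first by apply/hasP; exists (Ordinal N0) => //; rewrite mem_index_enum.
by move=> k _; have [] := sP k (ltn_ord k).
Qed.

End Arcs.

(** * The Riemann sphere and its two charts *)

Section Sphere.
Variable R : realType.
Local Notation C := (Cplx R).
Local Notation S := (RSphere R).

Lemma sphere_hausdorff : hausdorff_space S.
Proof.
apply: one_point_compactification_hausdorff; last exact: chausdorff.
move=> x _; exists [set z : C | cmod (z - x) <= 1].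
  rewrite withinET; apply/nbhs_cmodP; exists 1 => // w; exact: ltW.
split; last by apply: closed_cmod_le; exact: continuous_subC.
apply: (@compact_cbounded _ _ (1 + cmod x)).
  by apply: closed_cmod_le; exact: continuous_subC.
by move=> z z1; rewrite -(subrK x z) (le_trans (cmodD _ _))// lerD2r.
Qed.

Lemma within_agree (T : topologicalType) (A : set T) (f g : T -> S) (x : T) :
  {within A, continuous f} -> {within A, continuous g} -> A x ->
  closure [set y | A y /\ f y = g y] x -> f x = g x.
Proof.
move=> /subspace_continuousP cf /subspace_continuousP cg Ax cx.
apply: sphere_hausdorff => U V hU hV.
have nU : nbhs x [set y | A y -> U (f y)] := cf x Ax U hU.
have nV : nbhs x [set y | A y -> V (g y)] := cg x Ax V hV.
have [y [[Ay e] [/(_ Ay) Uy /(_ Ay) Vy]]] := cx _ (filterI nU nV).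
by exists (f y); split=> //; rewrite e.
Qed.

(** [sval] and [sinv] are the charts around 0 and around infinity. Outside their domains both take
    the default value 0 ([sinv] through [0^-1 = 0]), hence the exclusions of [None] and [Some 0]
    below. *)
Definition sval (h : S) : C := odflt 0 h.
Definition sinv (h : S) : C := if h is Some z then z^-1 else 0.

Lemma continuous_sval (h : S) : h <> None -> {for h, continuous sval}.
Proof. by case: h => // z _ A hA; exact: hA. Qed.

Lemma continuous_sinv (h : S) : h <> Some 0 -> {for h, continuous sinv}.
Proof.
case: h => [z /eqP z0|_].
  have z1 : z != 0 by apply: contra z0 => /eqP ->.
  move=> A hA; have : {for z, continuous (fun w : C => w^-1)}.
    by apply: derivable_continuous; apply: (derivable_invC (f := id)) => //; exact: derivable_id.
  by move=> /(_ A hA).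
apply/continuous_cmodP => e e0.
exists [set z : C | cmod (z - 0) <= e^-1].
  split; last by apply: closed_cmod_le; exact: continuous_subC.
  apply: (@compact_cbounded _ _ e^-1).
    by apply: closed_cmod_le; exact: continuous_subC.
  by move=> z /=; rewrite subr0.
move=> _ [[z /= /negP + <-]|->]; rewrite /= subr0 ?cmod0//.
rewrite subr0 -ltNge cmodV => h.
by rewrite -[e]invrK ltf_pV2// posrE ?invr_gt0//; apply: lt_trans h; rewrite invr_gt0.
Qed.

Lemma sval_inj (h1 h2 : S) : h1 <> None -> h2 <> None -> sval h1 = sval h2 -> h1 = h2.
Proof. by case: h1 h2 => [a|//] [b|//] _ _ /= ->. Qed.

Lemma sinv_inj (h1 h2 : S) : h1 <> Some 0 -> h2 <> Some 0 -> sinv h1 = sinv h2 -> h1 = h2.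
Proof.
case: h1 h2 => [a|] [b|] //= a0 b0 e.
- by congr Some; apply: invr_inj.
- by exfalso; apply: a0; congr Some; apply/eqP; rewrite -invr_eq0 e.
- by exfalso; apply: b0; congr Some; apply/eqP; rewrite -invr_eq0 -e.
Qed.

End Sphere.

(** * Uniqueness on the disc *)

Section DiscUniqueness.
Variable R : realType.
Local Notation C := (Cplx R).
Local Notation S := (RSphere R).

(** For [|p| = 1] and [ka > 0], a holomorphic covering of the punctured open disc by the upper half
    plane, carrying the real line to the circle; a small [ka] sends the closed half disc into a
    small neighbourhood of [p]. *)
Definition chart (p : C) (ka : R) (z : C) : C := p * cexp (mkc 0 ka * z).

Lemma derivable_chart p ka z : derivable (chart p ka) z 1.
Proof.
apply: derivable_mulC; first exact: derivable_cst.
apply: (@derivable_compC _ (fun z => mkc 0 ka * z) (@cexp R)); last exact: derivable_cexp.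
by apply: derivable_mulC; [exact: derivable_cst|exact: derivable_id].
Qed.

Lemma cmod_chart p ka z : cmod p = 1 -> cmod (chart p ka z) = expR (- (ka * cim z)).
Proof. by move=> p1; rewrite cmodM p1 mul1r cmod_cexp creM cre_mkc cim_mkc mul0r sub0r. Qed.

Lemma chart_disc p ka z : cmod p = 1 -> 0 < ka -> 0 <= cim z -> cDisc (chart p ka z).
Proof.
move=> p1 k0 z0; rewrite /cDisc /= cnorm_le1 cmod_chart// -expR0 ler_expR oppr_le0.
by rewrite mulr_ge0// ltW.
Qed.

Lemma chart_oDisc p ka z : cmod p = 1 -> 0 < ka -> 0 < cim z -> oDisc (chart p ka z).
Proof.
move=> p1 k0 z0; rewrite /oDisc /= cnorm_lt1 cmod_chart// -expR0 ltr_expR oppr_lt0.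
by rewrite mulr_gt0.
Qed.

Lemma chart_real p ka x : chart p ka (mkc x 0) = p * expi (ka * x).
Proof.
rewrite /chart expiE; congr (_ * cexp _).
by rewrite mkcM; congr mkc; ring.
Qed.

Lemma chart_surj p ka w : cmod p = 1 -> 0 < ka -> cmod w < 1 -> w != 0 ->
  exists2 z, 0 < cim z & chart p ka z = w.
Proof.
move=> p1 k0 w1 w0.
have p0 : p != 0 by rewrite -cmod_eq0 p1 oner_eq0.
have cw0 : 0 < cmod w by rewrite lt_neqAle cmod_ge0 eq_sym cmod_eq0 w0.
have [|t _ e] := @expi_surj R (w / p / mkc (cmod w) 0).
  by rewrite !cmodM !cmodV p1 cmod_real ger0_norm ?cmod_ge0// invr1 mulr1 divff// gt_eqF.
exists (mkc (t / ka) (- (ln (cmod w) / ka))).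
  by rewrite cim_mkc oppr_gt0 pmulr_llt0 ?invr_gt0// ln_lt0// cw0.
have -> : chart p ka (mkc (t / ka) (- (ln (cmod w) / ka))) = p * (mkc (cmod w) 0 * expi t).
  rewrite /chart; congr (_ * _).
  have -> : mkc 0 ka * mkc (t / ka) (- (ln (cmod w) / ka)) = mkc (ln (cmod w)) 0 + mkc 0 t.
    by rewrite mkcM mkcD; congr mkc; field; rewrite gt_eqF.
  rewrite cexpD expiE; congr (_ * _).
  by rewrite /cexp cre_mkc cim_mkc cos0 sin0 mulr1 mulr0 lnK.
have m0 : mkc (cmod w) 0 != 0 by rewrite -cmod_eq0 cmod_real normr_eq0 gt_eqF.
by rewrite -e; field; rewrite m0 p0.
Qed.

Lemma Atilde1_within (h : C -> S) : Atilde1 h -> {within @cDisc R, continuous h}.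
Proof.
move=> [hN|[]//]; apply/subspace_continuousP => z Dz A /nbhs_singleton hA.
have H : nbhs z [set w | cDisc w -> A (h w)].
  by apply: filterE => w Dw; rewrite (hN w Dw) -(hN z Dz).
exact: H.
Qed.

Lemma within_chart (h : C -> S) (T : topologicalType) (g : S -> T) p ka :
  cmod p = 1 -> 0 < ka -> {within @cDisc R, continuous h} ->
  (forall z, half_disc z -> {for h (chart p ka z), continuous g}) ->
  {within @half_disc R, continuous (fun z => g (h (chart p ka z)))}.
Proof.
move=> p1 k0 /subspace_continuousP ch cg; apply/subspace_continuousP => z Qz A hA.
have D w : half_disc w -> cDisc (chart p ka w) by move=> [_]; apply: chart_disc.
have H : nbhs (h (chart p ka z)) (g @^-1` A) := cg z Qz A hA.
have H2 : nbhs (chart p ka z) [set w | cDisc w -> A (g (h w))] := ch _ (D z Qz) _ H.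
have H3 : nbhs z [set w | cDisc (chart p ka w) -> A (g (h (chart p ka w)))].
  have c : chart p ka @ z --> chart p ka z := derivable_continuous (@derivable_chart p ka z).
  exact: (c _ H2).
by move: H3; apply: filterS => w H4 Qw; apply: H4; apply: D.
Qed.

Lemma oDisc_nbhs (w : C) : oDisc w -> nbhs w (@oDisc R).
Proof.
rewrite /oDisc /= cnorm_lt1 => w1; apply/nbhs_cmodP; exists (1 - cmod w); first by rewrite subr_gt0.
by move=> v vw /=; rewrite cnorm_lt1; have := cmodD (v - w) w; rewrite subrK; lra.
Qed.

Lemma derivable_sval_chart (h : C -> S) p ka z : cmod p = 1 -> 0 < ka -> 0 < cim z ->
  Atilde1 h -> h (chart p ka z) <> None ->
  derivable (fun z => sval (h (chart p ka z))) z 1.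
Proof.
move=> p1 k0 z0 [hN|[_ _ dh]] hz.
  by exfalso; apply: hz; apply: hN; apply: chart_disc => //; exact: ltW.
apply: (@derivable_compC _ (chart p ka) (fun w => sval (h w))); first exact: derivable_chart.
by apply: dh; exact: chart_oDisc.
Qed.

Lemma derivable_sinv_chart (h : C -> S) p ka z : cmod p = 1 -> 0 < ka -> 0 < cim z ->
  Atilde1 h -> h (chart p ka z) <> Some 0 ->
  derivable (fun z => sinv (h (chart p ka z))) z 1.
Proof.
move=> p1 k0 z0 Ah hz; have Dz : oDisc (chart p ka z) by exact: chart_oDisc.
have D w : oDisc w -> @cDisc R w by rewrite /oDisc /cDisc /= => /ltW.
apply: (@derivable_compC _ (chart p ka) (fun w => sinv (h w))); first exact: derivable_chart.
case: Ah => [hN|[_ hfin dh]].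
  apply: (@near_derivableC _ (fun=> 0)); last exact: derivable_cst.
  by move: (oDisc_nbhs Dz); apply: filterS => w /D /hN ->.
apply: (@near_derivableC _ (fun w => (sval (h w))^-1)).
  by move: (oDisc_nbhs Dz); apply: filterS => w /hfin; case: (h w).
apply: (@derivable_invC _ (fun w => sval (h w))); last exact: dh.
by move: (hfin _ Dz) hz; case: (h _) => //= a _ a1; apply/eqP => a0; apply: a1; rewrite a0.
Qed.

(** Each hit cell is enlarged by one mesh on either side, since open arcs miss their ends; the
    resulting arc has length [3 * ka / n], whence the divisor. *)
Lemma thick_hit_mass (E : set C) p ka d n : cmod p = 1 -> 0 < ka <= 1 ->
  E `<=` [set w | exists2 x, - 2^-1 <= x <= 2^-1 & w = p * expi (ka * x)] ->
  thick d E -> (0 < n)%N ->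
  d / (3 * ka) <= hit_mass n [set x | - 2^-1 <= x <= 2^-1 /\ E (p * expi (ka * x))].
Proof.
move=> p1 /andP[k0 k1] Ep tE n0; set X := [set x | _].
have [th _ pE] := expi_surj p1.
have dn : 0 < n%:R^-1 :> R by rewrite invr_gt0 ltr0n.
have dn1 : n%:R^-1 <= 1 :> R by rewrite invf_le1 ?ltr0n// ler1n.
pose lo k := th + ka * (grid R n k - n%:R^-1).
pose hi k := th + ka * (grid R n k + 2 * n%:R^-1).
have len k : hi k - lo k = 3 * ka * n%:R^-1 by rewrite /hi /lo; ring.
have gS k : grid R n k.+1 = grid R n k + n%:R^-1.
  have E1 : k.+1%:R = k%:R + 1 :> R by rewrite natr1.
  by rewrite /grid E1 mulrDl mul1r addrA.
have kd : 0 < ka * n%:R^-1 by rewrite mulr_gt0.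
have kd1 : ka * n%:R^-1 <= 1 by rewrite mulr_ile1// ltW.
pose s := [seq (lo k, hi k) | k <- iota 0 n & cell_hit n X k].
have pi2 := @pi_ge2 R.
have -> : hit_mass n X = arcs_len s / (3 * ka).
  rewrite /arcs_len big_map big_filter /hit_mass -(big_mkord xpredT (fun k => (cell_hit n X k)%:R / n%:R)).
  rewrite /index_iota subn0 [in RHS]big_mkcond /= mulr_suml; apply: eq_bigr => k _.
  by case: ifP => _; rewrite ?mul0r// len mul1r; field; rewrite gt_eqF// pnatr_eq0 -lt0n n0.
rewrite ler_pM2r ?invr_gt0 ?mulr_gt0//; apply: tE; split.
  move=> q /mapP[k _ ->] /=.
  by have := len k; rewrite -mulrA; lra.
move=> w Ew; have [x hx wx] := Ep w Ew.
(* The minimum assigns the right end [x = 1/2] to the last cell. *)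
pose k := minn (Num.truncn ((x + 2^-1) * n%:R)) n.-1.
have kn : (k < n)%N by rewrite /k -[X in (_ < X)%N](prednK n0) ltnS geq_minr.
have q0 : 0 <= (x + 2^-1) * n%:R by rewrite mulr_ge0//; lra.
have hk : grid R n k <= x <= grid R n k.+1.
  have := truncn_itv q0; set t := Num.truncn _ => /andP[t1 t2].
  have kt : k%:R <= (x + 2^-1) * n%:R.
    by apply: le_trans t1; rewrite ler_nat geq_minl.
  have tk : (x + 2^-1) * n%:R <= k.+1%:R.
    rewrite /k -/t; have [tn|tn] := leqP t n.-1; first exact: ltW.
    by rewrite prednK// -[leRHS]mul1r ler_wpM2r//; lra.
  have nn : 0 < n%:R :> R by rewrite ltr0n.
  rewrite /grid; rewrite -ler_pdivrMr// in kt; rewrite -ler_pdivlMr// in tk; lra.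
exists (lo k, hi k).
  have hit : cell_hit n X k.
    apply/asboolP; have Xx : X x by split => //; rewrite -wx.
    by exists x.
  by apply/mapP; exists k => //; rewrite mem_filter hit mem_iota.
rewrite wx pE -expiD; apply: open_arc_expi => /=.
  by have := len k; rewrite -mulrA; lra.
rewrite gS in hk; rewrite /lo /hi !ltrD2l !ltr_pM2l//; lra.
Qed.

(** The chart around 0 handles the first alternative and the chart around infinity the second. The
    third contradicts agreement on [E], which is nonempty because thick; it is there so that one of
    the three holds near every point of the circle. *)
Lemma chart_uniqueness (h1 h2 : C -> S) (E : set C) p ka d :
  cmod p = 1 -> 0 < ka <= 1 -> Atilde1 h1 -> Atilde1 h2 ->
  E `<=` [set w | exists2 x, - 2^-1 <= x <= 2^-1 & w = p * expi (ka * x)] ->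
  0 < d -> thick d E -> (forall w, E w -> h1 w = h2 w) ->
  [\/ forall z, half_disc z -> h1 (chart p ka z) <> None /\ h2 (chart p ka z) <> None,
      forall z, half_disc z -> h1 (chart p ka z) <> Some 0 /\ h2 (chart p ka z) <> Some 0 |
      forall z, half_disc z -> h1 (chart p ka z) <> h2 (chart p ka z)] ->
  forall z, half_disc_int z -> h1 (chart p ka z) = h2 (chart p ka z).
Proof.
move=> p1 k01 A1 A2 Ep d0 tE hE; have /andP[k0 k1] := k01.
pose X := [set x | - 2^-1 <= x <= 2^-1 /\ E (p * expi (ka * x))].
have hm n : (0 < n)%N -> d / (3 * ka) <= hit_mass n X by exact: thick_hit_mass.
have m0 : 0 < d / (3 * ka) by rewrite divr_gt0// mulr_gt0.
have UQ z : half_disc_int z -> @half_disc R z by move=> [? ?]; split; exact: ltW.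
have XQ x : - 2^-1 <= x <= 2^-1 -> @half_disc R (mkc x 0).
  by move=> hx; split; rewrite ?cim_mkc// cmod_real ler_norml; lra.
have general (g : S -> C) : 
  (forall z, half_disc z -> {for h1 (chart p ka z), continuous g}) ->
  (forall z, half_disc z -> {for h2 (chart p ka z), continuous g}) ->
  (forall z, half_disc_int z -> derivable (fun z => g (h1 (chart p ka z))) z 1) ->
  (forall z, half_disc_int z -> derivable (fun z => g (h2 (chart p ka z))) z 1) ->
  forall z, half_disc_int z -> g (h1 (chart p ka z)) = g (h2 (chart p ka z)).
  move=> c1 c2 d1 d2 z Uz; apply/eqP; rewrite -subr_eq0; apply/eqP.
  pose G z := g (h1 (chart p ka z)) - g (h2 (chart p ka z)).
  have cG : {within @half_disc R, continuous G}.
    have w1 := within_chart p1 k0 (Atilde1_within A1) c1.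
    have w2 := within_chart p1 k0 (Atilde1_within A2) c2.
    by move=> w; apply: cvgB; [exact: w1|exact: w2].
  have dG w : half_disc_int w -> derivable G w 1.
    by move=> Uw; exact: (derivable_subC (d1 w Uw) (d2 w Uw)).
  have zG x : X x -> - 2^-1 <= x <= 2^-1 /\ G (mkc x 0) = 0.
    by move=> [hx Ex]; split; [|rewrite /G chart_real (hE _ Ex) subrr].
  exact: (half_disc_uniqueness cG dG zG m0 hm Uz).
move=> [fin|nz|ne] z Uz.
- have [n1 n2] := fin z (UQ z Uz); apply: sval_inj => //; apply: general => // w Qw.
  + by apply: continuous_sval; have [] := fin w Qw.
  + by apply: continuous_sval; have [] := fin w Qw.
  + by apply: derivable_sval_chart => //; [case: Qw|have [] := fin w (UQ w Qw)].
  + by apply: derivable_sval_chart => //; [case: Qw|have [] := fin w (UQ w Qw)].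
- have [n1 n2] := nz z (UQ z Uz); apply: sinv_inj => //; apply: general => // w Qw.
  + by apply: continuous_sinv; have [] := nz w Qw.
  + by apply: continuous_sinv; have [] := nz w Qw.
  + by apply: derivable_sinv_chart => //; [case: Qw|have [] := nz w (UQ w Qw)].
  + by apply: derivable_sinv_chart => //; [case: Qw|have [] := nz w (UQ w Qw)].
- have [w Ew] := thick_nonempty d0 tE; have [x hx wx] := Ep w Ew.
  by exfalso; apply: (ne _ (XQ x hx)); rewrite chart_real -wx; exact: hE.
Qed.

Lemma half_plane_identity (F : C -> C) :
  (forall z, 0 < cim z -> derivable F z 1) ->
  (forall z, half_disc_int z -> F z = 0) -> forall z, 0 < cim z -> F z = 0.
Proof.
(* The disc of centre [i r] and radius [r] touches the real line and contains [z] as soon as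
   [|z|^2 < 2 r Im z]. It also contains [i/2], around which [F] vanishes. *)
move=> dF F0 z z0; pose r := cmod z ^+ 2 / cim z + 1.
have r1 : 1 <= r by rewrite lerDr divr_ge0 ?sqr_ge0// ltW.
have inH w : cmod (w - mkc 0 r) < r -> 0 < cim w.
  move=> h; have := le_lt_trans (cim_le_cmod _) h; rewrite !creimE ltr_norml; lra.
apply: (@identity_disc R F (mkc 0 r) (mkc 0 2^-1) r 4^-1).
- by move=> w /inH; exact: dF.
- by rewrite invr_gt0.
- have -> : mkc 0 2^-1 - mkc 0 r = mkc 0 (2^-1 - r) by rewrite mkcN mkcD subr0.
  rewrite (le_lt_trans (cmod_le_reim _))// !creimE normr0 add0r ler0_norm; lra.
- move=> w hw; apply: F0; split.
    have := cmodD (w - mkc 0 2^-1) (mkc 0 2^-1); rewrite subrK.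
    have := cmod_le_reim (mkc (0:R) 2^-1); rewrite !creimE normr0 add0r ger0_norm; lra.
  have := le_lt_trans (cim_le_cmod _) hw; rewrite !creimE ltr_norml; lra.
- rewrite -(@ltr_pXn2r _ 2) ?nnegrE ?cmod_ge0//; last by lra.
  have e : cmod z ^+ 2 = (r - 1) * cim z by rewrite /r addrK divfK// gt_eqF.
  move: e; rewrite !sqr_cmod !creimE subr0 => e; nra.
Qed.

Lemma chart_near p e : cmod p = 1 -> 0 < e -> exists2 rho : R, 0 < rho &
  forall p' ka z, cmod p' = 1 -> cmod (p' - p) < rho -> 0 < ka < rho -> half_disc z ->
  cmod (chart p' ka z - p) < e.
Proof.
move=> p1 e0; have e20 : 0 < e / 2 by rewrite divr_gt0.
have /derivable_continuous/continuous_cmodP/(_ _ e20)/nbhs_cmodP[d d0 Hd] := @derivable_cexp R 0.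
exists (Num.min (e / 2) d); first by rewrite lt_min e20.
move=> p' ka z p'1; rewrite !lt_min => /andP[pe _] /andP[k0 /andP[_ kd]] [z1 _].
have h : cmod (cexp (mkc 0 ka * z) - cexp 0) < e / 2.
  apply: Hd; rewrite subr0 cmodM.
  have -> : cmod (mkc 0 ka) = ka by rewrite /cmod !creimE expr0n add0r sqrtr_sqr gtr0_norm.
  by apply: le_lt_trans kd; rewrite ger_pMr.
have -> : chart p' ka z - p = p' * (cexp (mkc 0 ka * z) - cexp 0) + (p' - p).
  by rewrite cexp0 /chart; ring.
by rewrite (le_lt_trans (cmodD _ _))// cmodM p'1 mul1r; lra.
Qed.

(** Compactness of the circle provides one [ka] good for all centres; finitely many charts then
    cover the circle, and a thick part of [E] falls into one of them. *)
Theorem disc_uniqueness (h1 h2 : C -> S) (E : set C) (d : R) :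
  Atilde1 h1 -> Atilde1 h2 -> (forall w, E w -> cmod w = 1) ->
  0 < d -> thick d E -> (forall w, E w -> h1 w = h2 w) ->
  forall w, cDisc w -> h1 w = h2 w.
Proof.
move=> A1 A2 ET d0 tE hE.
pose good p ka := [\/ forall z, half_disc z -> h1 (chart p ka z) <> None /\ h2 (chart p ka z) <> None,
      forall z, half_disc z -> h1 (chart p ka z) <> Some 0 /\ h2 (chart p ka z) <> Some 0 |
      forall z, half_disc z -> h1 (chart p ka z) <> h2 (chart p ka z)].
have near_good p : cmod p = 1 ->
    exists2 rho : R, 0 < rho & forall p' ka, cmod p' = 1 -> cmod (p' - p) < rho ->
      0 < ka < rho -> good p' ka.
  move=> p1; have Dp : cDisc p by rewrite /cDisc /= cnorm_le1 p1.
  have /subspace_continuousP c1 := Atilde1_within A1.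
  have /subspace_continuousP c2 := Atilde1_within A2.
  have nb (U1 U2 : set S) : nbhs (h1 p) U1 -> nbhs (h2 p) U2 ->
      exists2 rho : R, 0 < rho & forall p' ka z, cmod p' = 1 -> cmod (p' - p) < rho ->
        0 < ka < rho -> half_disc z -> U1 (h1 (chart p' ka z)) /\ U2 (h2 (chart p' ka z)).
    move=> hU1 hU2.
    have nU1 : nbhs p [set w | cDisc w -> U1 (h1 w)] := c1 p Dp U1 hU1.
    have nU2 : nbhs p [set w | cDisc w -> U2 (h2 w)] := c2 p Dp U2 hU2.
    have [e e0 He] := (nbhs_cmodP _ _).1 (filterI nU1 nU2).
    have [rho rho0 H] := chart_near p1 e0; exists rho => // p' ka z p'1 pp kr Qz.
    have [//|H1 H2] := He (chart p' ka z); first exact: H.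
    have D : cDisc (chart p' ka z) by case: Qz => _; apply: chart_disc => //; case/andP: kr.
    by split; [exact: H1|exact: H2].
  have sep (a b : S) : a <> b -> exists U V : set S, [/\ nbhs a U, nbhs b V & forall x, U x -> V x -> False].
    move=> ab; have : ~ cluster (nbhs a) b by move/sphere_hausdorff.
    move=> /existsNP[U /existsNP[V /not_implyP[hU /not_implyP[hV h]]]].
    by exists U, V; split => // x Ux Vx; apply: h; exists x.
  (* A common finite value keeps both functions off infinity nearby, a common value infinity keeps
     both off 0, and distinct values have disjoint neighbourhoods. *)
  have [e12|ne] := pselect (h1 p = h2 p).
    case e1 : (h1 p) => [a|].
      have nN : h1 p <> None by rewrite e1.
      have [U [V [hU hV UV]]] := sep _ _ nN.
      have hU2 : nbhs (h2 p) U by rewrite -e12.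
      have [rho rho0 H] := nb U U hU hU2; exists rho => // p' ka p'1 pp kr.
      constructor 1 => z Qz; have [u1 u2] := H p' ka z p'1 pp kr Qz.
      have VN := nbhs_singleton hV.
      by split=> e; [rewrite e in u1; exact: (UV _ u1 VN)|rewrite e in u2; exact: (UV _ u2 VN)].
    have nN : h1 p <> Some 0 by rewrite e1.
    have [U [V [hU hV UV]]] := sep _ _ nN.
    have hU2 : nbhs (h2 p) U by rewrite -e12.
    have [rho rho0 H] := nb U U hU hU2; exists rho => // p' ka p'1 pp kr.
    constructor 2 => z Qz; have [u1 u2] := H p' ka z p'1 pp kr Qz.
    have VN := nbhs_singleton hV.
    by split=> e; [rewrite e in u1; exact: (UV _ u1 VN)|rewrite e in u2; exact: (UV _ u2 VN)].
  have [U [V [hU hV UV]]] := sep _ _ ne.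
  have [rho rho0 H] := nb U V hU hV; exists rho => // p' ka p'1 pp kr.
  constructor 3 => z Qz e; have [u1 u2] := H p' ka z p'1 pp kr Qz.
  by rewrite e in u1; exact: (UV _ u1 u2).
have [ka /andP[k0 k1] Hka] : exists2 ka : R, 0 < ka <= 1 & forall p, cmod p = 1 -> good p ka.
  have /compact_near_coveringP/near_covering_withinP := @compact_circle R.
  move=> /(_ _ (0 : R)^'+ (fun ka p => good p ka)) H.
  have : \forall ka \near (0:R)^'+, forall p, cmod p = 1 -> good p ka.
    apply: H => p p1; have [rho rho0 H] := near_good p p1.
    exists ([set p' | cmod (p' - p) < rho], [set t | 0 < t < rho]).
      split => /=; first by apply/nbhs_cmodP; exists rho.
      near=> t; apply/andP; split; near: t; first exact: nbhs_right_gt.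
      exact: nbhs_right_lt.
    by move=> [p' t] [/= h h'] p'1; exact: H.
  move=> Hn; near (0:R)^'+ => ka; exists ka; last by near: ka.
  by apply/andP; split; near: ka; [exact: nbhs_right_gt|exact: nbhs_right_le].
have pi0 := @pi_gt0 R.
have [N N0 HN] : exists2 N, (0 < N)%N & 2 * pi / N%:R <= ka.
  have a0 : 0 <= 2 * pi / ka by rewrite divr_ge0 ?ltW// mulr_gt0.
  have := archi_boundP a0; set n := Num.bound _ => hn.
  have hn0 : 0 < n%:R :> R by apply: le_lt_trans hn.
  exists n; first by rewrite ltr0n in hn0.
  by rewrite ler_pdivrMr// (mulrC ka) -ler_pdivrMr// ltW.
have NR : 0 < N%:R :> R by rewrite ltr0n.
(* Midpoints of [N] equal arcs, each of length at most [ka] and so within the image of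
   [[-1/2, 1/2]]. *)
pose ctr k : R := 2 * pi * (k%:R + 2^-1) / N%:R.
pose F k := [set w : C | exists2 x, - 2^-1 <= x <= 2^-1 & w = expi (ctr k) * expi (ka * x)].
have cov w : E w -> exists2 k, (k < N)%N & F k w.
  move=> /ET w1; have [t /andP[t0 t2] wt] := expi_surj w1.
  have q0 : 0 <= t * N%:R / (2 * pi) by rewrite divr_ge0 ?mulr_ge0// ltW.
  have := truncn_itv q0; set k := Num.truncn _ => /andP[k1' k2].
  rewrite ler_pdivlMr ?mulr_gt0// in k1'; rewrite ltr_pdivrMr ?mulr_gt0// in k2.
  have kk : k.+1%:R = k%:R + 1 :> R by rewrite natr1.
  exists k.
    rewrite -(@ltr_nat R) -(@ltr_pM2r _ (2 * pi)) ?mulr_gt0//.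
    by apply: le_lt_trans k1' _; rewrite mulrC ltr_pM2l.
  exists ((t - ctr k) / ka); last by rewrite (mulrC ka) divfK ?gt_eqF// -expiD subrKC.
  rewrite kk in k2.
  have b : `|t - ctr k| <= pi / N%:R.
    rewrite ler_norml; apply/andP; split.
      rewrite lerNl opprB lerBlDr /ctr -lerBlDl -mulrBl ler_pdivrMr//; lra.
    rewrite lerBlDr /ctr -mulrDl ler_pdivlMr//; lra.
  have b2 : pi / N%:R <= ka / 2.
    by rewrite ler_pdivlMr// mulrC mulrA.
  have := le_trans b b2; rewrite ler_norml => /andP[b3 b4].
  rewrite ler_pdivlMr// ler_pdivrMr//; lra.
have [k kN tk] := thick_pigeonhole N0 cov tE.
set p := expi (ctr k).
have p1 : cmod p = 1 by exact: cmod_expi.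
have eqU : forall z, half_disc_int z -> h1 (chart p ka z) = h2 (chart p ka z).
  apply: (@chart_uniqueness h1 h2 (E `&` F k) p ka (d / N%:R)) => //.
  - by rewrite k0.
  - by rewrite divr_gt0.
  - by move=> w [/hE].
  - exact: Hka.
have Ui : @half_disc_int R (mkc 0 2^-1).
  split; last by rewrite cim_mkc invr_gt0.
  rewrite (le_lt_trans (cmod_le_reim _))// !creimE normr0 add0r ger0_norm; lra.
have Di : @oDisc R (chart p ka (mkc 0 2^-1)) by apply: chart_oDisc => //; case: Ui.
have D w : oDisc w -> @cDisc R w by rewrite /oDisc /cDisc /= => /ltW.
have eqD w : oDisc w -> w != 0 -> h1 w = h2 w.
  (* If just one function is identically infinity, the other being finite inside, the equality at
     the image of [i/2] is contradictory. *)
  have [N1|[_ f1 dh1]] := A1; have [N2|[_ f2 dh2]] := A2.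
  - by move=> /D Dw _; rewrite N1// N2.
  - by exfalso; apply: (f2 _ Di); rewrite -eqU// N1//; exact: D.
  - by exfalso; apply: (f1 _ Di); rewrite eqU// N2//; exact: D.
  move=> Dw w0; have [|z z0 <-] := chart_surj p1 k0 _ w0; first by rewrite -cnorm_lt1.
  have Dz := chart_oDisc p1 k0 z0.
  apply: sval_inj; [exact: f1|exact: f2|].
  apply/eqP; rewrite -subr_eq0; apply/eqP.
  have dF v : 0 < cim v -> derivable (fun z => sval (h1 (chart p ka z)) - sval (h2 (chart p ka z))) v 1.
    move=> v0; have Dv := chart_oDisc p1 k0 v0.
    exact: (derivable_subC (derivable_sval_chart p1 k0 v0 A1 (f1 _ Dv))
                           (derivable_sval_chart p1 k0 v0 A2 (f2 _ Dv))).
  have F0 v : half_disc_int v -> sval (h1 (chart p ka v)) - sval (h2 (chart p ka v)) = 0.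
    by move=> Uv; rewrite eqU// subrr.
  exact: (half_plane_identity dF F0 z0).
move=> w Dw; apply: (within_agree (Atilde1_within A1) (Atilde1_within A2) Dw).
move=> A /nbhs_cmodP[e e0 He].
have w1 : cmod w <= 1 by rewrite -cnorm_le1.
(* The chart omits 0, which is approached through small positive reals; any other point [w] through
   [t w] with [1/2 <= t < 1]. *)
have [w0|w0] := eqVneq w 0.
  pose t := Num.min (e / 2) (2^-1).
  have t0 : 0 < t by rewrite lt_min divr_gt0 //= invr_gt0 ltr0n.
  have te : t <= e / 2 by rewrite ge_min lexx.
  have t1 : t <= 2^-1 by rewrite ge_min lexx orbT.
  have ct : cmod (mkc t 0) = t by rewrite cmod_real gtr0_norm.
  exists (mkc t 0); split; last by apply: He; rewrite w0 subr0 ct; lra.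
  have Dt : @oDisc R (mkc t 0) by rewrite /oDisc /= cnorm_lt1 ct; lra.
  by split; [exact: D|apply: eqD; rewrite // -cmod_eq0 ct gt_eqF].
pose t := Num.max 2^-1 (1 - e / 2).
have t2 : 2^-1 <= t by rewrite le_max lexx.
have te : 1 - e / 2 <= t by rewrite le_max lexx orbT.
have t1 : t < 1 by rewrite gt_max; lra.
have cw0 : 0 < cmod w by rewrite lt_neqAle cmod_ge0 eq_sym cmod_eq0 w0.
have ct : cmod (mkc t 0 * w) = t * cmod w by rewrite cmodM cmod_real ger0_norm//; lra.
exists (mkc t 0 * w); split.
  have Dt : @oDisc R (mkc t 0 * w).
    rewrite /oDisc /= cnorm_lt1 ct; apply: le_lt_trans t1.
    by rewrite ler_piMr//; lra.
  by split; [exact: D|apply: eqD; rewrite // -cmod_eq0 ct mulf_neq0 ?gt_eqF//; lra].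
apply: He; have -> : mkc t 0 * w - w = mkc (t - 1) 0 * w.
  have -> : mkc (t - 1) 0 = mkc t 0 - 1 by rewrite mkc1 mkcN mkcD subr0.
  by ring.
rewrite cmodM cmod_real ltr0_norm ?subr_lt0//.
have : - (t - 1) * cmod w <= - (t - 1) by rewrite ler_piMr//; lra.
lra.
Unshelve. all: by end_near. Qed.

End DiscUniqueness.

(** * Product topology and slices of closed sets *)

Section ProductTopology.
Variables (R : realType) (I : Type).
Local Notation C := (Cplx R).
Local Notation X := (CProd R I).
Local Notation J := {classic I}.

(** Basic neighbourhoods with a single radius. Indices are taken in [{classic I}] to have the
    decidable equality that sequences require. *)
Definition cyl_near (H : seq J) (e : R) (y x : X) : Prop :=
  forall i : J, i \in H -> cmod (x i - y i) < e.

Lemma coord_continuous (i : I) : continuous (fun x : X => x i : C).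
Proof. exact: (@proj_continuous J (fun=> C) i). Qed.

Lemma cyl_near_nbhs (H : seq J) (e : R) (y : X) : 0 < e -> nbhs y (cyl_near H e y).
Proof.
move=> e0; elim: H => [|i H ih]; first by apply: filterE => x i; rewrite in_nil.
have hi : nbhs y [set x : X | cmod (x i - y i) < e].
  have h : nbhs (y i) [set w : C | cmod (w - y i) < e] by apply/nbhs_cmodP; exists e.
  exact: (coord_continuous h).
apply: filterS2 hi ih => x /= h1 h2 k; rewrite inE => /orP[/eqP ->//|]; exact: h2.
Qed.

(** The filter generated by the cylinders converges to [y], because it does so in each coordinate
    and the product topology is the supremum of the coordinate topologies. *)
Lemma nbhs_cyl_near (y : X) (A : set X) : nbhs y A ->
  exists H : seq J, exists2 e : R, 0 < e & cyl_near H e y `<=` A.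
Proof.
move=> hA.
pose F := filter_from [set p : seq J * R | 0 < p.2] (fun p => cyl_near p.1 p.2 y).
have FF : Filter F.
  apply: filter_from_filter; first by exists ([::], 1) => /=.
  move=> [H1 e1] [H2 e2] /= h1 h2; exists (H1 ++ H2, Num.min e1 e2); first by rewrite /= lt_min h1.
  move=> x h; split=> i iH; have := h i; rewrite mem_cat iH ?orbT => /(_ isT);
    by rewrite lt_min => /andP[].
have : F --> y.
  apply/cvg_sup => i; rewrite cvg_image; last by rewrite eqEsubset; split=> v // _; exists (fun=> v).
  move=> W /= /nbhs_cmodP[e e0 eW]; rewrite nbhs_simpl.
  exists ((fun x : X => x i) @^-1` W).
    exists ([:: (i : J)], e) => //= x h; apply: eW; apply: h; exact: mem_head.
  by rewrite eqEsubset; split => [w [? + <-//]|w Ww]; exists (fun=> w).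
by move=> /(_ A hA) [[H e] /= e0 sub]; exists H, e.
Qed.

Lemma zeta_same (j : I) (z : X) (w : C) : zeta j z w j = w.
Proof. by rewrite /zeta; case: asboolP. Qed.

Lemma zeta_other (j i : I) (z : X) (w : C) : i <> j -> zeta j z w i = z i.
Proof. by move=> ij; rewrite /zeta; case: asboolP. Qed.

Lemma zeta_id (j : I) (z : X) : zeta j z (z j) = z.
Proof. by apply/funext => i; rewrite /zeta; case: asboolP => // ->. Qed.

Lemma zeta_zeta (j : I) (z : X) (v w : C) : zeta j (zeta j z v) w = zeta j z w.
Proof. by apply/funext => i; rewrite /zeta; case: asboolP. Qed.

Lemma TorusE : @Torus R I = [set x : X | forall i, cmod (x i) = 1].
Proof. by apply/seteqP; split => x h i; apply/cnorm_eq1; exact: h. Qed.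

Lemma compact_Torus : compact (@Torus R I).
Proof.
by rewrite TorusE; exact: (@tychonoff J (fun=> C) (fun=> [set w : C | cmod w = 1]) (fun=> @compact_circle R)).
Qed.

Lemma CProd_hausdorff : hausdorff_space X.
Proof. exact: (@hausdorff_product J (fun=> C) (fun=> @chausdorff R)). Qed.

Lemma closed_Torus : closed (@Torus R I).
Proof. exact: (compact_closed CProd_hausdorff compact_Torus). Qed.

Lemma Torus_zeta (j : I) (z : X) (w : C) : Torus z -> cmod w = 1 -> Torus (zeta j z w).
Proof.
rewrite TorusE => Tz w1 i; have [->|ij] := pselect (i = j); first by rewrite zeta_same.
by rewrite zeta_other.
Qed.

Lemma tube (S : set X) (j : I) (y : X) (W : set C) : closed S -> open W ->
  (forall w, cmod w = 1 -> S (zeta j y w) -> W w) ->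
  nbhs y [set x | forall w, cmod w = 1 -> S (zeta j x w) -> W w].
Proof.
move=> cS oW h.
have /compact_near_coveringP/(_ _ (nbhs y) (fun x w => S (zeta j x w) -> W w)) := @compact_circle R.
apply=> w w1; have [Sw|nS] := pselect (S (zeta j y w)).
  exists (W, setT); first by split=> /=; [exact: (open_nbhs_nbhs (conj oW (h w w1 Sw)))|exact: (@filterT _ (nbhs y) _)].
  by move=> [w' x] [].
have nb : nbhs (zeta j y w) (~` S) by apply: open_nbhs_nbhs; split => //; exact: closed_openC.
have [H [e e0 sub]] := nbhs_cyl_near nb.
exists ([set w' | cmod (w' - w) < e], cyl_near H e y).
  by split => /=; [apply/nbhs_cmodP; exists e|exact: cyl_near_nbhs].
move=> [w' x] [/= hw hx] Sx; exfalso; apply: (sub (zeta j x w')) Sx => i iH.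
have [ij|ij] := pselect ((i : I) = j); first by rewrite /zeta; case: asboolP.
by rewrite !zeta_other//; exact: hx.
Qed.

Definition arc (a b : R) : set C := [set w | exists2 t, a <= t <= b & w = expi t].

Lemma continuous_expi : continuous (@expi R).
Proof.
move=> t; apply: continuous_mkc; [exact: continuous_cos|exact: continuous_sin].
Qed.

Lemma closed_arc (a b : R) : closed (arc a b).
Proof.
apply: compact_closed; first exact: chausdorff.
have -> : arc a b = @expi R @` `[a, b].
  apply/seteqP; split => [w [t ht ->]|_ [t ht <-]]; first by exists t; rewrite //= in_itv.
  by exists t => //; move: ht; rewrite /= in_itv.
apply: continuous_compact; last exact: segment_compact.
by apply: continuous_subspaceT; exact: continuous_expi.
Qed.

Lemma closed_arc_cylinder n (iota : 'I_n -> I) (a b : 'I_n -> R) : closed (arc_cylinder iota a b).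
Proof.
have -> : arc_cylinder iota a b = @Torus R I `&`
    \bigcap_(k in [set: 'I_n]) [set x : X | arc (a k) (b k) (x (iota k))].
  apply/seteqP; split => x [Tx h]; split => //.
    by move=> k _; have [t [ht e]] := h k; exists t.
  by move=> k; have [t ht e] := h k Logic.I; exists t.
apply: closedI; first exact: closed_Torus.
apply: closed_bigI => k _.
apply: (@preimage_closed _ _ (fun x : X => x (iota k) : C) (arc (a k) (b k))).
  by move=> x _; exact: coord_continuous.
exact: closed_arc.
Qed.

Definition slice (j : I) (z : X) (S : set X) : set C := [set w | cmod w = 1 /\ S (zeta j z w)].

(** On the circle, an open arc is the trace of the complement of a closed arc, so [tube] applies to
    the union of these complements with the same [s]. *)
Lemma thin_slice_nbhs (S : set X) (j : I) (y : X) (s : seq (R * R)) : closed S ->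
  arcs_cover s (slice j y S) -> nbhs y [set x | arcs_cover s (slice j x S)].
Proof.
move=> cS [s1 s2].
pose W := \bigcup_(p in [set p | p \in s]) ~` arc p.2 (p.1 + 2 * pi).
have oW : open W by apply: bigcup_open => p _; apply: closed_openC; exact: closed_arc.
have H w : cmod w = 1 -> S (zeta j y w) -> W w.
  move=> w1 Sw; have [|p ps [_ h]] := s2 w; first by split.
  by exists p.
apply: filterS (tube cS oW H) => x h; split => // w [w1 Sw]; have [p ps hp] := h w w1 Sw.
by exists p => //; split.
Qed.

End ProductTopology.

(** * Measure estimates by cells of the torus *)

Section ProductMeasure.
Variables (R : realType) (I : Type).
Local Notation C := (Cplx R).
Local Notation X := (CProd R I).
Local Notation J := {classic I}.
Variable lam : {measure set (BorelCProd R I) -> \bar R}.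
Hypothesis hlam : is_torus_product_measure lam.

Lemma open_borel (A : set X) : open A -> measurable (A : set (BorelCProd R I)).
Proof. by move=> oA; apply: sub_sigma_algebra. Qed.

Lemma closed_borel (A : set X) : closed A -> measurable (A : set (BorelCProd R I)).
Proof. by move=> cA; rewrite -(setCK A); apply: measurableC; apply: open_borel; exact: closed_openC. Qed.

Lemma measure_finite_cover (T : eqType) (L : seq T) (A : T -> set (BorelCProd R I)) :
  (forall t, t \in L -> measurable (A t)) ->
  measurable [set x | exists2 t, t \in L & A t x] /\
  (lam [set x | exists2 t, t \in L & A t x] <= \sum_(t <- L) lam (A t))%E.
Proof.
elim: L => [|t L ih] mA.
  have -> : [set x | exists2 t, t \in [::] & A t x] = set0.
    by apply/seteqP; split => x // [t]; rewrite in_nil.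
  by rewrite measure0 big_nil.
have [|m1 l1] := ih; first by move=> u uL; apply: mA; rewrite inE uL orbT.
have mt : measurable (A t) by apply: mA; exact: mem_head.
have -> : [set x | exists2 u, u \in t :: L & A u x] = A t `|` [set x | exists2 u, u \in L & A u x].
  apply/seteqP; split => x.
    by move=> [u]; rewrite inE => /orP[/eqP -> ?|uL Au]; [left|right; exists u].
  by move=> [At|[u uL Au]]; [exists t => //; exact: mem_head|exists u => //; rewrite inE uL orbT].
split; first exact: measurableU.
rewrite big_cons; apply: (le_trans (measureU2 lam mt m1)).
exact: leeD2l.
Qed.

Lemma lam_le1 (A : set (BorelCProd R I)) : measurable A -> (lam A <= 1)%E.
Proof. by case: hlam => <- _ _ _ mA; apply: le_measure => //; rewrite inE. Qed.

(** The Lebesgue number lemma, with pairs of a finite set of coordinates and a radius as scales,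
    ordered by refinement; the filter [F] is that of fine scales. *)
Lemma Torus_lebesgue_number (A : Type) (P : A -> X -> Prop) :
  (forall y, Torus y -> exists a, nbhs y (P a)) ->
  exists H : seq J, exists2 e : R, 0 < e &
    forall y, Torus y -> exists a, forall x, cyl_near H e y x -> P a x.
Proof.
move=> hP.
pose F := filter_from [set p : seq J * R | 0 < p.2]
  (fun p => [set q : seq J * R | {subset p.1 <= q.1} /\ 0 < q.2 <= p.2]).
have FF : Filter F.
  apply: filter_from_filter; first by exists ([::], 1) => /=.
  move=> [H1 e1] [H2 e2] /= h1 h2; exists (H1 ++ H2, Num.min e1 e2); first by rewrite /= lt_min h1.
  move=> [H e] /= [sub /andP[e0]]; rewrite le_min => /andP[l1 l2].
  by split; split; rewrite ?e0//= => i iH; apply: sub; rewrite mem_cat iH ?orbT.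
have /compact_near_coveringP/near_covering_withinP := @compact_Torus R I.
move=> /(_ _ F (fun q y => exists a, forall x, cyl_near q.1 q.2 y x -> P a x) FF) cov.
have : \forall q \near F, forall y, Torus y -> exists a, forall x, cyl_near q.1 q.2 y x -> P a x.
  apply: cov => y Ty; have [a na] := hP y Ty.
  have [H [e e0 sub]] := nbhs_cyl_near na.
  have e20 : 0 < e / 2 by rewrite divr_gt0.
  exists (cyl_near H (e / 2) y, [set q : seq J * R | {subset H <= q.1} /\ 0 < q.2 <= e / 2]).
    by split => /=; [exact: cyl_near_nbhs|exists (H, e / 2)].
  move=> [y' [H' e']] [/= h1 [h2 /andP[_ e'e]]] _; exists a => x hx; apply: sub => i iH.
  have := h1 i iH; have := hx i (h2 i iH); have := cmod_triangle (x i) (y' i) (y i); lra.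
move=> [[H e] /= e0 h]; exists H, e => // y Ty.
by apply: (h (H, e)) Ty; split => //=; rewrite e0 lexx.
Qed.

Section cells.
Variables (H : seq J) (j : I) (N : nat).
Hypotheses (uH : uniq H) (jH : (j : J) \notin H).

(** A cell restricts the directions in [H] to grid arcs and direction [j], put at index 0, to an
    arbitrary arc. *)
Let idx (k : 'I_(size H).+1) : I := if unlift ord0 k is Some k' then tnth (in_tuple H) k' else j.

Let cell_lo (ka : {ffun 'I_(size H) -> 'I_N.+1}) (a : R) (k : 'I_(size H).+1) : R :=
  if unlift ord0 k is Some k' then 2 * pi * (ka k')%:R / N.+1%:R else a.
Let cell_hi (ka : {ffun 'I_(size H) -> 'I_N.+1}) (b : R) (k : 'I_(size H).+1) : R :=
  if unlift ord0 k is Some k' then 2 * pi * (ka k').+1%:R / N.+1%:R else b.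

Definition cell (ka : {ffun 'I_(size H) -> 'I_N.+1}) (p : R * R) : set X :=
  arc_cylinder idx (cell_lo ka p.1) (cell_hi ka p.2).

Let idx_inj : injective idx.
Proof.
move=> k k'; rewrite /idx.
case: unliftP => [i ->|->]; case: unliftP => [i' ->|->] //.
- by move=> /(tuple_uniqP (in_tuple H) uH) ->.
- by move=> e; move: jH; rewrite -e mem_tnth.
- by move=> e; move: jH; rewrite e mem_tnth.
Qed.

Lemma lam_cell ka p : p.1 <= p.2 <= p.1 + 2 * pi ->
  lam (cell ka p) = ((p.2 - p.1) / (2 * pi) * N.+1%:R ^- size H)%:E.
Proof.
have pi0 := @pi_gt0 R; have N0 : 0 < N.+1%:R :> R by rewrite ltr0n.
move=> hp; case: hlam => _ _ _ /(_ _ idx (cell_lo ka p.1) (cell_hi ka p.2) idx_inj) ->.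
  congr EFin; rewrite big_ord_recl /cell_lo /cell_hi unlift_none; congr (_ * _).
  rewrite -exprVn -[X in _ ^+ X]card_ord -prodr_const; apply: eq_bigr => k _.
  have E : (ka k).+1%:R = (ka k)%:R + 1 :> R by rewrite natr1.
  by rewrite liftK E; field; rewrite !gt_eqF//; lra.
move=> k; rewrite /cell_lo /cell_hi; case: unliftP => [i _|_] //.
have E : (ka i).+1%:R = (ka i)%:R + 1 :> R by rewrite natr1.
have d0 : 0 <= 2 * pi / N.+1%:R :> R by rewrite divr_ge0 ?mulr_ge0// ltW.
have d1 : 2 * pi / N.+1%:R <= 2 * pi :> R by rewrite ler_pdivrMr// ler_peMr ?mulr_ge0 ?(ltW pi0)// ler1n.
have -> : 2 * pi * (ka i).+1%:R / N.+1%:R = 2 * pi * (ka i)%:R / N.+1%:R + 2 * pi / N.+1%:R :> R.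
  by rewrite E; field; rewrite gt_eqF.
by rewrite lerDl d0 lerD2l d1.
Qed.

(** A representative of the cell: the initial point of each grid arc. Outside [H], where
    [cyl_near H] does not look, the coordinate is 1. *)
Definition cell_corner (ka : {ffun 'I_(size H) -> 'I_N.+1}) : X := fun i : J =>
  if insub (index i H) is Some k then expi (2 * pi * (ka k)%:R / N.+1%:R) else 1.

Lemma Torus_cell_corner ka : Torus (cell_corner ka).
Proof.
rewrite TorusE => i; rewrite /cell_corner; case: insub => [k|]; last exact: cmod1.
exact: cmod_expi.
Qed.

Lemma cell_exists (x : X) : Torus x -> exists ka : {ffun 'I_(size H) -> 'I_N.+1},
  forall k : 'I_(size H), exists2 t, 2 * pi * (ka k)%:R / N.+1%:R <= t <= 2 * pi * (ka k).+1%:R / N.+1%:R &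
     x (tnth (in_tuple H) k) = expi t.
Proof.
rewrite TorusE => Tx; have pi0 := @pi_gt0 R.
have N0 : 0 < N.+1%:R :> R by rewrite ltr0n.
have h (k : 'I_(size H)) : exists m : 'I_N.+1, exists2 t,
   2 * pi * m%:R / N.+1%:R <= t <= 2 * pi * m.+1%:R / N.+1%:R & x (tnth (in_tuple H) k) = expi t.
  have [t /andP[t0 t2] e] := expi_surj (Tx (tnth (in_tuple H) k)).
  have q0 : 0 <= t * N.+1%:R / (2 * pi) by rewrite divr_ge0 ?mulr_ge0// ltW.
  have := truncn_itv q0; set m := Num.truncn _ => /andP[m1 m2].
  rewrite ler_pdivlMr ?mulr_gt0// in m1; rewrite ltr_pdivrMr ?mulr_gt0// in m2.
  have mN : (m < N.+1)%N.
    rewrite -(@ltr_nat R) -(@ltr_pM2r _ (2 * pi)) ?mulr_gt0//.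
    by apply: le_lt_trans m1 _; rewrite mulrC ltr_pM2l.
  exists (Ordinal mN), t => //=.
  by rewrite ler_pdivrMr// ler_pdivlMr// (mulrC _ m%:R) m1 /= (mulrC _ m.+1%:R) ltW.
exists [ffun k => projT1 (cid (h k))] => k; rewrite ffunE.
by case: (cid (h k)).
Qed.

End cells.

(* Cut the torus, along finitely many directions other than [j], into cells so small
   that each is contained, with its [j]-saturation, in [U], or has all its fibres in
   direction [j] covered by the same arcs. *)
Lemma lam_thin_fibres (S U : set X) (j : I) (c : R) :
  closed S -> S `<=` @Torus R I -> open U -> 0 < c ->
  (forall y, Torus y -> thick (c * pi) (slice j y S) -> U y) ->
  (lam S <= lam U + (c / 2)%:E)%E.
Proof.
move=> cS ST oU c0 thickU; have pi0 := @pi_gt0 R.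
(* [Some s] is a short cover of the slice through [x]; [None] says that the whole circle through [x]
   in direction [j] lies in [U]. Both are insensitive to the coordinate [x j], which allows [j] to
   be deleted from the directions to be subdivided. *)
pose P (a : option (seq (R * R))) (x : X) := if a is Some s then
  arcs_cover s (slice j x S) /\ arcs_len s < c * pi else forall w, cmod w = 1 -> U (zeta j x w).
have slice_zeta x v : slice j (zeta j x v) S = slice j x S.
  by apply/seteqP; split => w; rewrite /slice /= zeta_zeta.
have P_zeta a x v : P a (zeta j x v) -> P a x.
  case: a => [s|] /=; first by rewrite slice_zeta.
  by move=> h w w1; rewrite -(zeta_zeta j x v); exact: h.
have local y : Torus y -> exists a, nbhs y (P a).
  move=> Ty; have [ty|] := pselect (thick (c * pi) (slice j y S)).
    exists None; have h w : cmod w = 1 -> (~` U) (zeta j y w) -> set0 w.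
      by move=> w1; apply; apply: thickU; [exact: Torus_zeta|rewrite slice_zeta].
    apply: filterS (tube (open_closedC oU) open0 h) => x hx w w1.
    by apply: contrapT => nU; exact: (hx w w1 nU).
  move=> /existsNP[s /not_implyP[cs /negP]]; rewrite -ltNge => ls.
  by exists (Some s); apply: filterS (thin_slice_nbhs cS cs) => x hx; split.
have [H0 [e e0 He0]] := Torus_lebesgue_number local.
pose H : seq J := undup [seq i <- H0 | i != (j : J)].
have uH : uniq H by exact: undup_uniq.
have jH : (j : J) \notin H by rewrite mem_undup mem_filter eqxx.
have He y : Torus y -> exists a, forall x, cyl_near H e y x -> P a x.
  move=> /He0[a ha]; exists a => x hx; apply: (P_zeta a x (y j)); apply: ha => i iH0.
  have [->|ij] := pselect ((i : I) = j); first by rewrite zeta_same subrr cmod0.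
  rewrite zeta_other//; apply: hx; rewrite mem_undup mem_filter iH0 andbT.
  exact/eqP.
have [N hN] : exists N : nat, forall u : R, 0 <= u <= 2 * pi / N.+1%:R -> cmod (expi u - 1) < e.
  have /continuous_cmodP/(_ e e0)/nbhs_ballP[d /= d0 hd] := @continuous_expi R 0.
  have q0 : 0 <= 2 * pi / d by rewrite divr_ge0 ?mulr_ge0// ltW.
  have := archi_boundP q0; set N := Num.bound _ => hN.
  exists N => u /andP[u0 u1].
  rewrite -expi0; apply: hd; rewrite /ball /= sub0r normrN ger0_norm//.
  apply: le_lt_trans u1 _; rewrite ltr_pdivrMr ?ltr0n// (mulrC d) -ltr_pdivrMr//.
  by apply: lt_trans hN _; rewrite ltr_nat.
have ha ka := cid (He _ (@Torus_cell_corner H N ka)).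
pose sg ka : seq (R * R) := if projT1 (ha ka) is Some s then s else [::].
pose B ka : set (BorelCProd R I) := [set x | exists2 p, p \in sg ka & @cell H j N ka p x].
have sg_ok ka : (exists w : X, cyl_near H e (@cell_corner H N ka) w) -> 
    (forall p, p \in sg ka -> p.1 <= p.2 <= p.1 + 2 * pi) /\ arcs_len (sg ka) <= c * pi.
  rewrite /sg; case: (ha ka) => /= -[s|] h [w nw]; last first.
    by split => //; rewrite /arcs_len big_nil mulr_ge0// ltW.
  by have [[s1 _] s2] := h w nw; split => //; exact: ltW.
(* The corner is near itself, so the length bound holds for every cell, also for one that misses
   [S]. *)
have sgP ka := sg_ok ka (ex_intro _ (@cell_corner H N ka)
   (fun i _ => eq_ind_r (fun z => cmod z < e) (eq_ind_r (fun z => z < e) e0 (cmod0 R)) (subrr _))).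
have cover : S `<=` U `|` [set x | exists2 ka, ka \in enum {ffun 'I_(size H) -> 'I_N.+1} & B ka x].
  move=> x Sx; have Tx := ST x Sx.
  have [ka hka] := @cell_exists H N x Tx.
  have near_x : cyl_near H e (cell_corner ka) x.
    move=> i iH; have iH' : (index i H < size H)%N by rewrite index_mem.
    have [t /andP[t1 t2]] := hka (Ordinal iH').
    rewrite (tnth_nth i) /= nth_index// => ->.
    rewrite /cell_corner insubT/=; set s := 2 * pi * _ / _.
    have -> : expi t - expi s = expi s * (expi (t - s) - 1) by rewrite mulrBr mulr1 -expiD subrKC.
    rewrite cmodM cmod_expi mul1r; apply: hN; rewrite subr_ge0 t1 lerBlDl.
    apply: le_trans t2 _; rewrite /s -mulrDl -[X in _ + X]mulr1 -mulrDr natr1.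
    exact: lexx.
  case E : (projT1 (ha ka)) => [s|]; have hP := projT2 (ha ka) x near_x; rewrite E in hP.
    right; exists ka; first by rewrite mem_enum.
    case: hP => [[s1 s2] _]; have [|p ps /open_arcP[t ht xt]] := s2 (x j).
      by split; [by move: Tx; rewrite TorusE; apply|rewrite zeta_id].
    exists p; first by rewrite /sg E.
    split=> // k; case: unliftP => [k' _|_]; last by exists t.
    by have [t' ht' e'] := hka k'; exists t'.
  left; rewrite -(zeta_id j x); apply: hP.
  by move: Tx; rewrite TorusE; apply.
(* Arcs of total length at most [c * pi] form a fraction [c / 2] of the circle. Summing over the
   [N.+1 ^ size H] choices of [ka] gives [c / 2]. *)
have mB ka : measurable (B ka) /\ (lam (B ka) <= (c / 2 * N.+1%:R ^- size H)%:E)%E.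
  have [|m1 l1] := @measure_finite_cover _ (sg ka) (@cell H j N ka).
    by move=> p _; apply: closed_borel; exact: closed_arc_cylinder.
  split => //; apply: le_trans l1 _; have [ok len] := sgP ka.
  have -> : (\sum_(p <- sg ka) lam (cell j ka p) =
     \sum_(p <- sg ka) ((p.2 - p.1) / (2 * pi) * N.+1%:R ^- size H)%:E)%E.
    by rewrite [LHS]big_seq [RHS]big_seq; apply: eq_bigr => p /ok; exact: lam_cell.
  rewrite sumEFin lee_fin -!mulr_suml ler_wpM2r ?invr_ge0 ?exprn_ge0//.
  by rewrite ler_pdivrMr ?mulr_gt0//; apply: le_trans len _; lra.
have [|m2 l2] := @measure_finite_cover _ (enum {ffun 'I_(size H) -> 'I_N.+1}) B.
  by move=> ka _; exact: (mB ka).1.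
have mU := open_borel oU.
apply: (@le_trans _ _ (lam (U `|` [set x | exists2 ka, ka \in enum {ffun 'I_(size H) -> 'I_N.+1} & B ka x]))).
  by apply: le_measure => //; rewrite inE; [exact: closed_borel|exact: measurableU].
apply: le_trans (measureU2 lam mU m2) _; apply: leeD2l; apply: le_trans l2 _.
apply: (@le_trans _ _ (\sum_(ka <- enum {ffun 'I_(size H) -> 'I_N.+1}) (c / 2 * N.+1%:R ^- size H)%:E)%E).
  by apply: lee_sum => ka _; exact: (mB ka).2.
rewrite sumEFin lee_fin big_enum /= sumr_const card_ffun !card_ord -[leLHS]mulr_natr natrX divfK//.
Qed.

End ProductMeasure.

(** * Freeing coordinates and conclusion *)

(** The new set consists of the torus points whose slice of [S] in direction [j] is thick, whether
    or not they lie in [S]. On such a slice the two functions of the coordinate [j] agree, so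
    [disc_uniqueness] applies to them. *)
Lemma agree_step (R : realType) (I : Type)
  (lam : {measure set (BorelCProd R I) -> \bar R})
  (hlam : is_torus_product_measure lam) (f g : CProd R I -> RSphere R)
  (j : {classic I}) (l : seq {classic I}) (S : set (CProd R I)) :
  Atilde f -> Atilde g -> closed S -> S `<=` @Torus R I -> (0 < lam S)%E ->
  (forall z, S z -> forall x, cPolydisc x ->
     (forall i : {classic I}, i \notin l -> x i = z i) -> f x = g x) ->
  exists S', [/\ closed S', S' `<=` @Torus R I, (0 < lam S')%E &
    forall z, S' z -> forall x, cPolydisc x ->
     (forall i : {classic I}, i \notin j :: l -> x i = z i) -> f x = g x].
Proof.
move=> [_ Af] [_ Ag] cS ST Spos Sl.
have pi0 := @pi_gt0 R.
have mS := closed_borel cS.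
have S1 := lam_le1 hlam mS.
have fS : lam S \is a fin_num.
  by rewrite ge0_fin_numE//; apply: le_lt_trans S1 _; rewrite ltry.
pose c := fine (lam S).
have c0 : 0 < c by rewrite fine_gt0// Spos /=; apply: le_lt_trans S1 _; rewrite ltry.
have Sc : lam S = c%:E by rewrite fineK.
have cp : 0 < c * pi by rewrite mulr_gt0.
(* The threshold is half of [2 * pi * c], the mean slice length to be expected of a set of measure
   [c]. *)
pose S' := [set z | Torus z /\ thick (c * pi) (slice j z S)].
have cS' : closed S'.
  rewrite -(setCK S'); apply: open_closedC; rewrite openE => z nS'; rewrite /interior.
  have [Tz|nT] := pselect (Torus z); last first.
    have : nbhs z (~` @Torus R I) by apply: open_nbhs_nbhs; split => //; exact: closed_openC (@closed_Torus R I).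
    by apply: filterS => w nTw [].
  have : ~ thick (c * pi) (slice j z S) by move=> t; apply: nS'.
  move=> /existsNP[s /not_implyP[cs /negP]]; rewrite -ltNge => ls.
  by apply: filterS (thin_slice_nbhs cS cs) => w cw [_ /(_ s cw)]; rewrite leNgt ls.
exists S'; split => //; first by move=> z [].
  (* Were [S'] null, outer regularity would enclose it in an open set of measure below [c / 2], and
     [lam_thin_fibres] would yield [lam S < c]. *)
  rewrite ltNge; apply/negP => S'0.
  have : (lam S' < (c / 2)%:E)%E by apply: le_lt_trans S'0 _; rewrite lte_fin divr_gt0.
  case: (hlam) => _ outer _ _; rewrite (outer _ (closed_borel cS')).
  move=> /ereal_inf_lt[_ [U [oU S'U] <-] Uc].
  have := lam_thin_fibres hlam cS ST oU c0 (fun y Ty ty => S'U y (conj Ty ty)).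
  rewrite Sc leNgt => /negP; apply.
  have -> : c%:E = ((c / 2)%:E + (c / 2)%:E)%E by rewrite -EFinD; congr EFin; lra.
  by rewrite lteD2rE.
move=> z [Tz tz] x Px xz.
rewrite -(zeta_id j x).
apply: (@disc_uniqueness R (fun w => f (zeta j x w)) (fun w => g (zeta j x w))
  (slice j z S) (c * pi) (Af j x Px) (Ag j x Px) _ cp tz) => //.
- by move=> w [].
- move=> w [w1 Sw]; apply: (Sl _ Sw).
    move=> i; have [->|ij] := pselect (i = j); last by rewrite zeta_other//; exact: Px.
    by rewrite zeta_same /cDisc /= cnorm_le1 w1.
  move=> i il; have [->|ij] := pselect ((i : I) = j); first by rewrite !zeta_same.
  rewrite !zeta_other//; apply: xz; rewrite inE negb_or il andbT.
  exact/eqP.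
Qed.


Unset Implicit Arguments.

Theorem theorem4p4 (R : realType) (I : Type) (I_ne : inhabited I)
  (lam : {measure set BorelCProd R I -> \bar R})
  (hlam : is_torus_product_measure lam)
  (K : set (CProd R I)) (KT : K `<=` @Torus R I) (Kc : compact K)
  (Kpos : (0 < lam K)%E) :
  forall f g : CProd R I -> RSphere R,
    @Atilde R I f -> @Atilde R I g ->
    (forall x, K x -> f x = g x) ->
    forall x, @cPolydisc R I x -> f x = g x.
Proof.
move=> f g [cf Af] [cg Ag] fgK x Px.
pose agree (l : seq {classic I}) (z : CProd R I) := forall x, cPolydisc x ->
  (forall i : {classic I}, i \notin l -> x i = z i) -> f x = g x.
have step l : exists S, [/\ closed S, S `<=` @Torus R I, (0 < lam S)%E & forall z, S z -> agree l z].
  elim: l => [|j l [S [cS ST Spos Sl]]].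
    exists K; split => //; first exact: compact_closed (@CProd_hausdorff R I) Kc.
    move=> z Kz y _ yz; have -> : y = z by apply/funext => i; exact: yz.
    exact: fgK.
  have At_f : Atilde f by split.
  have At_g : Atilde g by split.
  exact: (agree_step hlam j At_f At_g cS ST Spos Sl).
apply: (within_agree cf cg Px) => A nA.
have [H [e e0 sub]] := nbhs_cyl_near nA.
have [S [cS ST Spos Sl]] := step H.
have [z Sz] : exists z, S z.
  apply: contrapT => h; have E : S = set0 by apply/seteqP; split => // z Sz; apply: h; exists z.
  by move: Spos; rewrite E measure0 ltxx.
(* [y] follows [x] on [H], hence lies in the given neighbourhood of [x], and follows [z] elsewhere,
   hence is a point of agreement. *)
pose y : CProd R I := fun i : {classic I} => if i \in H then x i else z i.
have Py : cPolydisc y.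
  move=> i; rewrite /y; case: ifP => _; first exact: Px.
  by rewrite /cDisc /= (ST z Sz i).
exists y; split; first by split => //; apply: (Sl z Sz y Py) => i iH; rewrite /y (negbTE iH).
by apply: sub => i iH; rewrite /y iH subrr cmod0.
Qed.
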